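(* Assume that $\xi_0,\dots,\xi_n$ are independent random variables such that either all of them are of Type I with the same fixed parameter $N$, or all of them are of Type II with uniform (fixed) implicit constants. Let $P_n(x)=\sum_{i=0}^n\xi_i x^i$, and let $p_{\pm1}=p_{\pm 1}(n)$ be the probability that $P_n$ has a double root at $1$ or a double root at $-1$. Then for any constant $C>0$ there exists a constant $B>0$ such that for all sufficiently large $n$ $$\mathbf{P}\Big(\exists x\in\mathbb{R}:\ P_n(x)=0 \ \wedge\ |P_n'(x)|\le n^{-B}\Big)\le p_{\pm1}+n^{-C}.$$
   Context: Type I (parameter $N$, a positive integer): $\mathbf{P}(\xi=i)=\frac{1}{2N}$ for each $i\in\{\pm1,\dots,\pm N\}$. Type II (parameters $(p,\varepsilon_0)$, with $p>1$, $\varepsilon_0>0$): $\xi$ has mean zero, its distribution has a $p$-integrable density $\rho$, and its $(2+\varepsilon_0)$-moment is bounded. ''Uniform implicit constants'' means that $p,\varepsilon_0$ and a bound $K$ are fixed (independent of $n$ and $j$) with $\|\rho_j\|_{L^p}\le K$ and $\mathbf{E}|\xi_j|^{2+\varepsilon_0}\le K$ for all $j$, where $\rho_j$ is the density of $\xi_j$; the $\xi_j$ need not be identically distributed. A double root of $P_n$ at $a$ means $P_n(a)=P_n'(a)=0$. $B$ and the threshold for $n$ depend only on $C$ and the fixed parameters. *)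

(* Defs.v *)
From HB Require Import structures.
From mathcomp Require Import all_boot all_order all_algebra.
From mathcomp Require Import all_classical all_reals all_analysis.

Set Implicit Arguments.
Unset Strict Implicit.
Unset Printing Implicit Defensive.

Import Order.TTheory GRing.Theory Num.Theory.
Import numFieldNormedType.Exports.

Local Open Scope classical_set_scope.
Local Open Scope ring_scope.

Definition mutually_independent (R : realType) (d : measure_display)
    (T : measurableType d) (P : probability T R) (I : finType)
    (X : I -> {RV P >-> R}) : Prop :=
  forall (J : {set I}) (A : I -> set R),
    (forall i, i \in J -> measurable (A i)) ->
    P (\bigcap_(i in [set` J]) (X i @^-1` A i)) =
    (\prod_(i in J) P (X i @^-1` A i))%E.

Definition has_density (R : realType) (d : measure_display)
    (T : measurableType d) (P : probability T R) (X : {RV P >-> R})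
    (rho : R -> R) : Prop :=
  [/\ measurable_fun setT rho,
      forall x, 0 <= rho x
    & forall A : set R, measurable A ->
        distribution P X A = (\int[lebesgue_measure]_(x in A) (rho x)%:E)%E].

Definition type_I (R : realType) (N : nat) (d : measure_display)
    (T : measurableType d) (P : probability T R) (X : {RV P >-> R}) : Prop :=
  forall k : int, (0 < `|k| <= N)%N -> pmf X k%:~R = (2 * N%:R)^-1.

(* Mean zero is meaningful: the last bound makes X integrable. *)
Definition type_II (R : realType) (p eps0 K : R) (d : measure_display)
    (T : measurableType d) (P : probability T R) (X : {RV P >-> R}) : Prop :=
  [/\ ('E_P[X] = 0)%E,
      exists2 rho : R -> R, has_density X rho &
        ('N[lebesgue_measure]_(p%:E) [EFin \o rho] <= K%:E)%E
    & ('E_P[fun w => (`|X w| `^ (2 + eps0))%R] <= K%:E)%E].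

(* A coefficient class carries the parameters which are fixed before C; K is
   the common bound on the L^p norm of the density and on the moment. *)
Inductive coef_class (R : realType) : Type :=
  | TypeI of nat
  | TypeII of R & R & R.
Arguments TypeI {R}.

Definition valid_class (R : realType) (c : coef_class R) : Prop :=
  match c with
  | TypeI N => (0 < N)%N
  | TypeII p eps0 _ => 1 < p /\ 0 < eps0
  end.

Definition of_class (R : realType) (c : coef_class R) (d : measure_display)
    (T : measurableType d) (P : probability T R) (X : {RV P >-> R}) : Prop :=
  match c with
  | TypeI N => type_I N X
  | TypeII p eps0 K => type_II p eps0 K X
  end.

Definition random_poly (R : realType) (d : measure_display)
    (T : measurableType d) (P : probability T R) (n : nat)
    (xi : 'I_n.+1 -> {RV P >-> R}) (w : T) : {poly R} :=
  \sum_(i < n.+1) xi i w *: 'X^i.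

Definition double_root (R : realType) (q : {poly R}) (a : R) : Prop :=
  q.[a] = 0 /\ q^`().[a] = 0.

(* Main.v *)
(* Coefficients with a density: freeze all coefficients but the constant one [xi_0] and
   write P = xi_0 + G.  Moving from a near-double root x in [-1, 1] to the right, up to 1 or
   to the next solution y of |G'| = 2 delta, changes P by O(delta); so xi_0 is within
   O(delta) of one of the O(n) values - G(y), which are determined by G.  Reversing the order
   of the coefficients exchanges |x| <= 1 and |x| >= 1.

   Integer coefficients: the symmetries x -> - x and x -> 1 / x reduce to 0 <= x <= 1, and if
   1 - x <= n^(-6) then P(1) and P'(1) are integers of absolute value less than 1.  In the
   remaining range, choose disjoint sets of coefficients, arranged in groups; a set is aligned
   if its coefficients are +-(a fixed sign pattern), and flipping the first aligned set of each
   group changes P(x) by amounts which are lacunary from one group to the next.  Hence P is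
   determined by its class modulo flips as soon as |P(x)| is below the smallest of these
   amounts, and each group costs a constant factor in the number of classes.  The union over
   all x is handled as above: flipping the groups with small amounts only changes P to some
   P~ with nearly the same derivative, and starting from a near-double root one moves to the
   next solution of |P~'| = kappa or to the next point of a coarse grid.  The former are O(n)
   points which depend only on the class of P.  Away from 1 the sets are single coefficients
   x^(k j) with x^k about 1 / 4; near 1 they carry the signs of Thue-Morse polynomials. *)

Require Import Defs.
From HB Require Import structures.
From mathcomp Require Import all_boot all_order all_algebra.
From mathcomp Require Import boolp polyrcf.
From mathcomp Require Import zify ring lra.

Set Implicit Arguments.
Unset Strict Implicit.
Unset Printing Implicit Defensive.

Import Order.TTheory GRing.Theory Num.Theory.

Local Open Scope ring_scope.

(** * Near-double roots and critical points *)

Lemma poly_roots_seq (F : fieldType) (p : {poly F}) :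
  exists rs : seq F, (size rs <= size p)%N /\
    (p != 0 -> forall x, root p x -> x \in rs).
Proof.
have [m] := ubnP (size p); elim: m p => // m IHm p /ltnSE sz_p.
have [->|p0] := eqVneq p 0; first by exists [::]; split=> //; rewrite eqxx.
have [[x rx]|nr] := boolp.pselect (exists x, root p x); last first.
  by exists [::]; split=> // _ x rx; case: nr; exists x.
have /factor_theorem [q qE] := rx.
have q0 : q != 0 by apply: contraNneq p0 => q0; rewrite qE q0 mul0r.
have szE : size p = (size q).+1 by rewrite qE size_Mmonic ?monicXsubC // size_XsubC addn2.
have [|rs [szrs rsP]] := IHm q; first by rewrite -ltnS -szE.
exists (x :: rs); split=> [|_ y]; first by rewrite szE.
by rewrite qE rootM root_XsubC inE => /orP[/(rsP q0)->|->]; rewrite ?orbT.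
Qed.

Section RealPoly.
Variable R : rcfType.
Implicit Types (f g p : {poly R}) (a b x y : R).

Lemma poly_mean_value_le f a b c : a <= b ->
  (forall y, a <= y <= b -> `|f^`().[y]| <= c) ->
  `|f.[b] - f.[a]| <= (b - a) * c.
Proof.
rewrite le_eqVlt => /predU1P[->|ab] fc; first by rewrite !subrr normr0 mul0r.
have [y yab ->] := poly_mvt f ab.
rewrite normrM mulrC (gtr0_norm (_ : 0 < b - a)) ?subr_gt0 //.
rewrite ler_pM2l ?subr_gt0 // fc //.
by move: yab; rewrite in_itv /= => /andP[/ltW-> /ltW->].
Qed.

(** The point [y] is the least root of [p] in [[a, b]], or [b] if there is none or [p = 0]: by the
    intermediate value theorem [p] cannot become positive before its first root. *)
Lemma poly_neg_until_root p (rs : seq R) a b : a <= b -> p.[a] <= 0 ->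
  (p != 0 -> forall x, root p x -> x \in rs) ->
  exists y, [/\ a <= y <= b, y = b \/ y \in rs &
    forall x, a <= x <= y -> p.[x] <= 0].
Proof.
move=> ab pa rsP.
have [->|p0] := eqVneq p 0.
  by exists b; split; rewrite ?lexx ?ab //; [left|move=> x _; rewrite horner0].
have {}rsP := rsP p0.
move: (erefl [seq x <- rs | a <= x <= b & root p x]).
case: {2}[seq _ <- _ | _] => [|r0 s] Es.
  exists b; split; rewrite ?lexx ?ab //; first by left.
  move=> x /andP[ax xb]; rewrite leNgt; apply/negP => px.
  have [|z /andP[az zx] rz] := poly_ivt (p := p) ax; first by rewrite pa ltW.
  suff: z \in [seq x <- rs | a <= x <= b & root p x] by rewrite Es.
  by rewrite mem_filter az rz rsP // (le_trans zx).
pose y := \big[Num.min/r0]_(r <- s) r.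
have yIn : y \in r0 :: s.
  rewrite /y; elim: s {Es y} r0 => [|r1 s IHs] r0; first by rewrite big_nil mem_head.
  rewrite big_cons minElt; case: ifP => _; first by rewrite !inE eqxx orbT.
  by have := IHs r0; rewrite !inE => /orP[]->; rewrite ?orbT.
have yle r : r \in r0 :: s -> y <= r.
  rewrite /y; elim: s r {Es y yIn} => [|r1 s IHs] r; first by rewrite inE big_nil => /eqP->.
  rewrite big_cons inE ge_min => /orP[/eqP->|]; first by rewrite IHs ?mem_head ?orbT.
  by rewrite inE => /orP[/eqP->|rs']; rewrite ?lexx // IHs ?orbT // inE rs' orbT.
move: yIn; rewrite -Es mem_filter => /andP[/andP[/andP[ay yb] ry] yrs].
exists y; split; rewrite ?ay ?yb //; first by right.
move=> x /andP[ax xy]; rewrite leNgt; apply/negP => px.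
have [|z /andP[az zx] rz] := poly_ivt (p := p) ax; first by rewrite pa ltW.
have : z \in r0 :: s by rewrite -Es mem_filter az rz rsP // (le_trans zx) // (le_trans xy).
move/yle => yz; have zE : x = y by apply/le_anti; rewrite xy (le_trans yz).
by move: px; rewrite zE (rootP ry) ltxx.
Qed.

(** The candidates are the roots of [g'^2 - k^2], so they depend on [g] and [k] alone and serve all
    intervals at once. *)
Lemma near_critical_candidates g k : 0 <= k ->
  exists rs : seq R, (size rs <= (size g).*2.+1)%N /\
  forall a b, a <= b -> `|g^`().[a]| <= k ->
  exists y, [/\ a <= y <= b, y = b \/ y \in rs &
    forall x, a <= x <= y -> `|g^`().[x]| <= k].
Proof.
move=> k0; pose p := g^`() ^+ 2 - (k ^+ 2)%:P.
have pE x : (p.[x] <= 0) = (`|g^`().[x]| <= k).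
  by rewrite /p !hornerE subr_le0 -real_normK ?num_real // ler_pXn2r ?nnegrE.
have [rs [szrs rsP]] := poly_roots_seq p.
have szp : (size p <= (size g).*2.+1)%N.
  rewrite /p (leq_trans (size_polyD _ _)) // geq_max size_polyN size_polyC.
  apply/andP; split; last by case: (_ != 0).
  have [g0|g0] := eqVneq g^`() 0; first by rewrite g0 expr0n size_poly0.
  have sg : (size g^`() < size g)%N.
    by apply: lt_size_deriv; apply: contraNneq g0 => ->; rewrite deriv0.
  by rewrite expr2 size_mul // (leq_trans (leq_pred _)) // -addnn leqW // leq_add // ltnW.
exists rs; split; first exact: leq_trans szrs szp.
move=> a b ab ga.
have [|y [aby yb ya]] := poly_neg_until_root ab _ rsP; first by rewrite pE.
by exists y; split=> // x /ya; rewrite pE.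
Qed.

Lemma grid_cell a l (T : nat) x : (0 < T)%N -> a <= x <= a + T%:R * l ->
  exists2 i, (i < T)%N & a + i%:R * l <= x <= a + i.+1%:R * l.
Proof.
case: T => // T _; elim: T => [|T IHT] /andP[ax xT].
  by exists 0%N => //; rewrite mul0r addr0 ax.
have [xT'|/ltW xT'] := leP x (a + T.+1%:R * l); last by exists T.+1; rewrite // xT'.
by have [|i iT xi] := IHT; [rewrite ax|exists i => //; exact: ltnW].
Qed.

(* Moving right from a near-double root [x] of [F w], stop at the next grid point
   or at the first point where the derivative of [F (nu w)] stops being small.
   The latter points are few and only depend on [nu w], while [w] is
   determined by [nu w] once [F w] is known to be small at a given point. *)
Lemma card_near_double_roots (Omega : finType) (F : Omega -> {poly R})
    (nu : Omega -> Omega) (n T A B : nat) (a l delta eta s : R) :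
  (0 < T)%N -> 0 <= l -> 0 <= delta -> 0 <= eta -> l * (delta + 2 * eta) <= s ->
  (forall w, (size (F w) <= n.+1)%N) ->
  (forall w x, a <= x <= a + T%:R * l ->
     `|(F w)^`().[x] - (F (nu w))^`().[x]| <= eta) ->
  (forall w w' x, a <= x <= a + T%:R * l -> nu w = nu w' ->
     `|(F w).[x]| <= s -> `|(F w').[x]| <= s -> w = w') ->
  (forall x, a <= x <= a + T%:R * l -> leq #|[set w | `|(F w).[x]| <= s]| A) ->
  (#|nu @: setT| <= B)%N ->
  leq #|[set w | `[< exists x, [/\ a <= x <= a + T%:R * l, (F w).[x] = 0
       & `|(F w)^`().[x]| <= delta] >]]| (T * A + B * (n.*2 + 3)).
Proof.
move=> T0 l0 d0 e0 sE szF dF inj gridA nuB.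
have k0 : 0 <= delta + eta by rewrite addr_ge0.
have /boolp.choice [rs rsP] := fun g => near_critical_candidates g k0.
pose good w y := (a <= y <= a + T%:R * l) && (`|(F w).[y]| <= s).
pose cell (i : 'I_T) := [set w | good w (a + i.+1%:R * l)].
pose bad1 := \bigcup_i cell i.
pose bad2 := [set w | has (good w) (rs (F (nu w)))].
have gridP i : (i < T)%N -> a <= a + i.+1%:R * l <= a + T%:R * l.
  move=> iT; rewrite lerDl mulr_ge0 ?ler0n // lerD2l ler_wpM2r // ler_nat //.
have sub : [set w | `[< exists x, [/\ a <= x <= a + T%:R * l, (F w).[x] = 0
       & `|(F w)^`().[x]| <= delta] >]] \subset bad1 :|: bad2.
  apply/subsetP => w; rewrite !inE => /asboolP[x [xI Fx dFx]].
  have [i iT /andP[xi1 xi2]] := grid_cell T0 xI.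
  have gx : `|(F (nu w))^`().[x]| <= delta + eta.
    rewrite -[X in `|X|](subKr (F w)^`().[x]) (le_trans (ler_normB _ _)) //.
    by rewrite lerD // dF.
  have [y [/andP[xy yt] yrs yb]] := (rsP (F (nu w))).2 _ _ xi2 gx.
  have yI : a <= y <= a + T%:R * l.
    have /andP[ax _] := xI; have /andP[_ tT] := gridP _ iT.
    by rewrite (le_trans ax) // (le_trans yt).
  have Fy : good w y.
    rewrite /good yI /=; apply: le_trans sE.
    (* Between [x] and [y] the derivative of [F w] is at most [eta + (delta + eta)], and
       [y - x <= l] because both points lie in one grid cell. *)
    rewrite -[(F w).[y]]subr0 -Fx.
    apply: (@le_trans _ _ ((y - x) * (delta + 2 * eta))).
      apply: poly_mean_value_le => // z /andP[xz zy].
      rewrite -[X in `|X|](subrK (F (nu w))^`().[z]) (le_trans (ler_normD _ _)) //.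
      rewrite (_ : delta + _ = eta + (delta + eta)); last by ring.
      rewrite lerD //; last by rewrite yb // xz.
      apply: dF; have /andP[ax _] := xI; have /andP[_ yT] := yI.
      by rewrite (le_trans ax) // (le_trans zy).
    rewrite ler_wpM2r ?addr_ge0 ?mulr_ge0 ?ler0n //.
    move: xi1 yt; rewrite -(natr1 i) mulrDl mul1r => xi1 yt.
    by rewrite lerBlDr (le_trans yt) // addrA [l + _]addrC lerD2r.
  apply/orP; case: yrs => [yE|yrs]; [left|right].
    by apply/bigcupP; exists (Ordinal iT) => //; rewrite inE -yE.
  by apply/hasP; exists y.
apply: leq_trans (subset_leq_card sub) _.
apply: leq_trans (leq_card_setU _ _) _; apply: leq_add.
  apply: (@leq_trans (\sum_i #|cell i|)%N).
    rewrite /bad1; elim/big_rec2: _ => [|i m U _ le]; first by rewrite cards0.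
    by rewrite (leq_trans (leq_card_setU _ _)) // leq_add2l.
  rewrite -[X in (_ <= X * _)%N]card_ord -sum_nat_const; apply: leq_sum => i _; rewrite /cell.
  apply: leq_trans (gridA (a + i.+1%:R * l) _); last exact: gridP.
  by apply: subset_leq_card; apply/subsetP => w; rewrite !inE => /andP[].
(* On [bad2], [w] is recovered from [nu w] and the position of the first good candidate in the list
   of [F (nu w)]; the list has at most [2 (n + 1) + 1] entries. *)
pose idx w := find (good w) (rs (F (nu w))).
have idxP w : w \in bad2 -> (idx w < n.*2 + 3)%N.
  rewrite inE has_find => /leq_trans; apply.
  by have [le _] := rsP (F (nu w)); have := szF (nu w); lia.
have n3 : (0 < n.*2 + 3)%N by rewrite addn3.
(* By [idxP] the default [Ordinal n3] is never reached on [bad2]. *)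
pose code w := (nu w, odflt (Ordinal n3) (insub (idx w))).
have code_inj : {in bad2 &, injective code}.
  move=> w w' wb w'b [nuE].
  rewrite (insubT (fun i => i < n.*2 + 3)%N (idxP _ wb)).
  rewrite (insubT (fun i => i < n.*2 + 3)%N (idxP _ w'b)) /= => -[idxE].
  have hw : has (good w) (rs (F (nu w))) by move: wb; rewrite inE.
  have hw' : has (good w') (rs (F (nu w'))) by move: w'b; rewrite inE.
  have /andP[yI Fw] := nth_find 0 hw.
  have /andP[_ Fw'] := nth_find 0 hw'.
  rewrite -/(idx w) idxE nuE in yI Fw; rewrite -/(idx w') in Fw'.
  exact: inj yI nuE Fw Fw'.
rewrite -(card_in_imset code_inj) (leq_trans (subset_leq_card (_ : _ \subset
  setX (nu @: setT) setT))) //.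
  by apply/subsetP => _ /imsetP[w _ ->]; rewrite inE /= imset_f ?inE.
by rewrite cardsX cardsT card_ord leq_mul.
Qed.
End RealPoly.

(** * Sign flips of aligned blocks of coefficients *)

(** Overwriting [w] by [u] on [D] stays in [T], and [w] is recovered from the result together with
    its restriction to [D], for which there are at most [#|S| ^ #|D|] choices. *)
Lemma card_sub_ffun_ge (X S : finType) (D : {set X}) (u : S)
    (T : {set {ffun X -> S}}) :
  (forall w w' : {ffun X -> S}, w \in T ->
     (forall i, i \notin D -> w' i = w i) -> w' \in T) ->
  (#|T| <= #|S| ^ #|D| * #|[set w in T | [forall i in D, w i == u]]|)%N.
Proof.
move=> TD; set T' := [set w in T | _].
pose ov (w : {ffun X -> S}) : {ffun X -> S} := [ffun i => if i \in D then u else w i].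
pose re (w : {ffun X -> S}) : {ffun X -> S} := [ffun i => if i \in D then w i else u].
have inj : injective (fun w => (re w, ov w)).
  move=> w w' [/ffunP reE /ffunP ovE]; apply/ffunP => i.
  by have := reE i; have := ovE i; rewrite !ffunE; case: ifP.
rewrite -(card_imset (mem T) inj) -(card_pffun_on u D (mem S)).
rewrite -(cardsE (pffun_on u D (mem S))) -cardsX; apply: subset_leq_card; apply/subsetP => _ /imsetP[w wT ->].
rewrite !inE /=; apply/andP; split; [|apply/andP; split].
- apply/pffun_onP; split; last by move=> ? /imageP[i _ ->].
  by apply/subsetP => i; rewrite !inE ffunE; case: ifP => // _; rewrite eqxx.
- by apply: TD wT _ => i /negPf iD; rewrite ffunE iD.
- by apply/forall_inP => i iD; rewrite ffunE iD.
Qed.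

Section Flips.
Variables (X S : finType) (neg : S -> S) (u : S).
Hypotheses (negK : involutive neg) (neg_u : neg u != u).
Variables (I : nat -> nat -> {set X}) (M r0 wd : nat).
Hypothesis I_gt0 : forall j r, (j < M)%N -> (r < r0)%N -> I j r != set0.
Hypothesis I_card : forall j r, (j < M)%N -> (r < r0)%N -> (#|I j r| <= wd)%N.
Hypothesis I_disj : forall j r j' r' i, (j < M)%N -> (r < r0)%N ->
  (j' < M)%N -> (r' < r0)%N -> i \in I j r -> i \in I j' r' -> j = j' /\ r = r'.

Local Notation Omega := {ffun X -> S}.
Implicit Types (w : Omega) (J : pred nat).

Definition aligned (A : {set X}) w :=
  [forall i in A, w i == u] || [forall i in A, w i == neg u].
(* Equal to [r0] if no candidate set of the group [j] is aligned. *)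
Definition rank_of j w := find (fun r => aligned (I j r) w) (iota 0 r0).
Definition sel j w := if (rank_of j w < r0)%N then I j (rank_of j w) else set0.
Definition sg j w := (rank_of j w < r0)%N && [forall i in sel j w, w i == neg u].
Definition flip J w : Omega :=
  [ffun i => if [exists j : 'I_M, J j && (i \in sel j w)] then neg (w i) else w i].
(* Configurations with the same image differ by the signs of the selected sets of the
   groups below [b]; alignment, hence the selection, is invariant under flips. *)
Definition canon b w := flip (fun j => (j < b)%N && sg j w) w.

Lemma rank_of_aligned j w : (rank_of j w < r0)%N -> aligned (I j (rank_of j w)) w.
Proof.
move=> lt; have := @nth_find _ 0%N (fun r => aligned (I j r) w) (iota 0 r0).
by rewrite has_find size_iota => /(_ lt); rewrite nth_iota.
Qed.

Lemma mem_sel j w i : i \in sel j w -> (rank_of j w < r0)%N /\ i \in I j (rank_of j w).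
Proof. by rewrite /sel; case: ifP; rewrite ?inE. Qed.

Lemma flip_on J w j r i : (j < M)%N -> (r < r0)%N -> i \in I j r ->
  flip J w i = if J j && (rank_of j w == r) then neg (w i) else w i.
Proof.
move=> jM rr iI; rewrite ffunE; congr (if _ then _ else _).
apply/existsP/idP => [[j' /andP[Jj' /mem_sel[lt]]]|/andP[Jj /eqP rk]].
  by case/(I_disj jM rr (ltn_ord j') lt iI) => jE rE; rewrite jE Jj' -rE eqxx.
by exists (Ordinal jM); rewrite Jj /sel /= rk rr.
Qed.

(** By disjointness a flip either fixes [I j r] pointwise or negates all of it; the latter exchanges
    the two alternatives of alignment. *)
Lemma aligned_flip J w j r : (j < M)%N -> (r < r0)%N ->
  aligned (I j r) (flip J w) = aligned (I j r) w.
Proof.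
move=> jM rr; rewrite /aligned.
have [|] := boolP (J j && (rank_of j w == r)) => Jr; last first.
  congr orb; apply/eq_forallb => i; apply: implyb_id2l => iI;
    by rewrite (flip_on J w jM rr iI) (negPf Jr).
rewrite orbC; congr orb; apply/eq_forallb => i; apply: implyb_id2l => iI.
  by rewrite (flip_on J w jM rr iI) Jr (inj_eq (can_inj negK)).
by rewrite (flip_on J w jM rr iI) Jr -{1}(negK u) (inj_eq (can_inj negK)).
Qed.

Lemma rank_of_flip J w j : (j < M)%N -> rank_of j (flip J w) = rank_of j w.
Proof.
move=> jM; apply: eq_in_find => r; rewrite mem_iota => /andP[_ rr].
exact: aligned_flip.
Qed.

Lemma sel_flip J w j : (j < M)%N -> sel j (flip J w) = sel j w.
Proof. by move=> jM; rewrite /sel rank_of_flip. Qed.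

Lemma flip_sel J w j i : (j < M)%N -> i \in sel j w ->
  flip J w i = if J j then neg (w i) else w i.
Proof.
by move=> jM /mem_sel[lt iI]; rewrite (flip_on J w jM lt iI) eqxx andbT.
Qed.

Lemma sel_value w j : (rank_of j w < r0)%N ->
  (forall i, i \in sel j w -> w i = if sg j w then neg u else u).
Proof.
move=> lt i iS; rewrite /sg lt /=; case: ifP => [/forall_inP/(_ i iS)/eqP//|nn].
have := rank_of_aligned lt; rewrite /aligned; move: nn iS; rewrite /sel lt.
by move=> ->; rewrite orbF => iI /forall_inP/(_ i iI)/eqP.
Qed.

Lemma sg_flip J w j : (j < M)%N ->
  sg j (flip J w) = (rank_of j w < r0)%N && (J j (+) sg j w).
Proof.
move=> jM; rewrite /sg rank_of_flip // sel_flip //; case: ltnP => //= lt.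
(* On an empty set both signs would hold vacuously; a point of the set makes them exclusive. *)
have [i0 i0S] : exists i, i \in sel j w.
  by apply/set0Pn; rewrite /sel lt; exact: I_gt0.
have sE := sel_value lt; rewrite /sg lt /= in sE.
have negE i : i \in sel j w -> (flip J w i == neg u) =
    (J j (+) [forall i in sel j w, w i == neg u]).
  move=> iS; rewrite (flip_sel J jM iS) sE //; case: (J j); case: ifP => _ /=;
    by rewrite ?negK ?eqxx // eq_sym (negPf neg_u).
apply/forall_inP/idP => [/(_ i0 i0S)|H i iS]; first by rewrite negE.
by rewrite negE.
Qed.

Lemma flip_flip J w : flip J (flip J w) = w.
Proof.
apply/ffunP => i; rewrite ffunE.
rewrite (eq_existsb (P2 := fun j : 'I_M => J j && (i \in sel j w))); last first.
  by move=> j /=; rewrite sel_flip.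
by rewrite ffunE; case: [exists j, _] => //; rewrite negK.
Qed.

Lemma flip_ext J J' w : (forall j, (j < M)%N -> J j = J' j) -> flip J w = flip J' w.
Proof.
move=> JJ; apply/ffunP => i; rewrite !ffunE.
rewrite (eq_existsb (P2 := fun j : 'I_M => J' j && (i \in sel j w))) //.
by move=> j; rewrite JJ.
Qed.

Lemma canon_sel b w w' j : (j < M)%N -> canon b w = canon b w' -> sel j w = sel j w'.
Proof.
by move=> jM E; rewrite -(sel_flip (fun j => (j < b)%N && sg j w) w jM) -/(canon b w) E sel_flip.
Qed.

(** Equal images select the same sets, so equal signs mean that the same flip was applied, and a
    flip is an involution. *)
Lemma canon_inj b w w' : canon b w = canon b w' ->
  (forall j, (j < M)%N -> (j < b)%N -> sg j w = sg j w') -> w = w'.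
Proof.
move=> E sE; rewrite -(flip_flip (fun j => (j < b)%N && sg j w) w) -/(canon b w) E.
rewrite (@flip_ext _ (fun j => (j < b)%N && sg j w')) ?flip_flip //.
by move=> j jM; case: (ltnP j b) => //= jb; rewrite sE.
Qed.

(** Normal forms modulo flips of the groups below [b]; counting them bounds the number of
    classes. *)
Definition plain b := [set w | [forall j : 'I_M, (j < b)%N ==> ~~ sg j w]].

Lemma canon_plain b w : canon b w \in plain b.
Proof.
rewrite inE; apply/forallP => j; apply/implyP => jb.
by rewrite sg_flip // jb /= addbb andbF.
Qed.

Lemma aligned_ext w w' (A : {set X}) : (forall i, i \in A -> w' i = w i) -> aligned A w' = aligned A w.
Proof.
by move=> E; rewrite /aligned; congr orb; apply/eq_forallb => i;
  apply: implyb_id2l => iA; rewrite E.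
Qed.

Lemma local_ext w w' j : (forall r i, (r < r0)%N -> i \in I j r -> w' i = w i) ->
  rank_of j w' = rank_of j w /\ sg j w' = sg j w.
Proof.
move=> E; have rkE : rank_of j w' = rank_of j w.
  apply: eq_in_find => r; rewrite mem_iota => /andP[_ rr].
  by apply: aligned_ext => i; exact: E.
split=> //; rewrite /sg rkE; case: ltnP => //= lt.
rewrite /sel rkE lt; apply/eq_forallb => i; apply: implyb_id2l => iI.
by rewrite (E _ _ lt iI).
Qed.

(** For [m = r0] these are the normal forms in which group [b] offers nothing to flip, hence the
    ones that group [b] does not halve. *)
Definition stray b m := [set w in plain b | [forall r : 'I_r0, (r < m)%N ==> ~~ aligned (I b r) w]].

(** Membership in [stray b m] does not depend on the coefficients in [I b m], so a proportion of at
    least [#|S| ^ - wd] of it is constantly [u] there and drops out at the next rank. *)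
Lemma card_stray b m : (b < M)%N -> (m <= r0)%N ->
  (#|stray b m| * #|S| ^ (wd * m) <= #|plain b| * (#|S| ^ wd - 1) ^ m)%N.
Proof.
move=> bM; have S0 : (0 < #|S|)%N by apply/card_gt0P; exists u.
elim: m => [|m IHm] mr.
  by rewrite muln0 !expn0 !muln1 subset_leq_card //; apply/subsetP => w; rewrite inE => /andP[].
have {}IHm := IHm (ltnW mr).
set D := I b m.
have sub : stray b m.+1 \subset stray b m.
  apply/subsetP => w; rewrite !inE => /andP[-> /forallP st]; apply/forallP => r.
  by apply/implyP => rm; have := st r; rewrite ltnS ltnW.
have sle := subset_leq_card sub.
(* Changing [w] on [D] affects neither the signs of the groups below [b] nor the alignment of the
   earlier candidates, so [card_sub_ffun_ge] applies; configurations constantly [u] on [D] leave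
   [stray]. *)
have step : (#|stray b m| <= #|S| ^ wd * (#|stray b m| - #|stray b m.+1|))%N.
  have := @card_sub_ffun_ge X S D u (stray b m).
  move=> /(_ _)/leq_trans; apply.
    move=> w w'; rewrite !inE => /andP[/forallP pl /forallP st] E.
    apply/andP; split; apply/forallP => j; apply/implyP => jb.
      have jn : (j : nat) <> b by move=> jE; rewrite jE ltnn in jb.
      have [|_ ->] := @local_ext w w' j; last by have := pl j; rewrite jb.
      move=> r i rr iI; apply: E; apply/negP => iD.
      by have [/jn] := I_disj (ltn_ord j) rr bM mr iI iD.
    have := st j; rewrite jb /=; rewrite (@aligned_ext w w') // => i iI.
    apply: E; apply/negP => iD.
    by have [_ jE] := I_disj bM (ltn_ord j) bM mr iI iD; rewrite jE ltnn in jb.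
  rewrite leq_mul //; first by rewrite leq_pexp2l // I_card.
  rewrite leq_subRL ?subset_leq_card // -cardsUI.
  rewrite [X in (_ + X)%N](_ : _ = 0%N) ?addn0; last first.
    apply/eqP; rewrite cards_eq0; apply/eqP/setP => w; rewrite !inE.
    apply/negP => /andP[/andP[_ /forallP st] /andP[_ al]].
    by have := st (Ordinal mr); rewrite /= ltnSn /aligned al.
  apply: subset_leq_card; rewrite subUset sub; apply/subsetP => w.
  by rewrite inE => /andP[].
have Sw : (0 < #|S| ^ wd)%N by rewrite expn_gt0 S0.
have le1 : (#|stray b m.+1| * #|S| ^ wd <= #|stray b m| * (#|S| ^ wd - 1))%N.
  have h1 := leq_mul (leqnn (#|S| ^ wd)) sle; have h2 := leq_mul (leqnn #|stray b m|) Sw.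
  by move: step h1 h2; rewrite mulnBr mulnBr muln1; set q := (#|S| ^ wd)%N; lia.
rewrite mulnS expnD mulnA (leq_trans (leq_mul le1 (leqnn _))) //.
by rewrite expnS; nia.
Qed.

(** Flipping group [b] is a bijection between the configurations of [plain b] with the two signs
    [P1] and [P2]. Passing to [plain b.+1] discards [P1] and keeps [P2] and the stray ones. *)
Lemma card_plainS b : (b < M)%N -> (2 * #|plain b.+1| = #|plain b| + #|stray b r0|)%N.
Proof.
move=> bM.
pose P1 := [set w in plain b | sg b w].
pose P2 := [set w in plain b | (rank_of b w < r0)%N && ~~ sg b w].
have strayE : stray b r0 = [set w in plain b | ~~ (rank_of b w < r0)%N].
  apply/setP => w; rewrite !inE; congr andb.
  rewrite /rank_of -[X in (_ < X)%N](size_iota 0) -has_find.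
  apply/forallP/hasPn => [H r|H r].
    by rewrite mem_iota /= => rr; have := H (Ordinal rr); rewrite rr.
  by rewrite ltn_ord H // mem_iota /=.
have plE : plain b.+1 = plain b :\: P1.
  apply/setP => w; rewrite !inE; apply/forallP/andP => [H|[H1 /forallP H2] j].
    split; last by apply/forallP => j; apply/implyP => jb; have := H j; rewrite ltnS ltnW.
    by rewrite negb_and; have := H (Ordinal bM); rewrite ltnSn /= => ->; rewrite orbT.
  apply/implyP; rewrite ltnS leq_eqVlt => /orP[/eqP jE|jb]; last by have := H2 j; rewrite jb.
  by move: H1; rewrite negb_and jE => /orP[/negP[]|//]; apply/forallP.
have P1s : P1 \subset plain b by apply/subsetP => w; rewrite inE => /andP[].
have c1 : #|plain b| = (#|P1| + #|plain b.+1|)%N.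
  by rewrite plE cardsD (setIidPr P1s) subnKC // subset_leq_card.
have c2 : #|plain b.+1| = (#|P2| + #|stray b r0|)%N.
  rewrite -cardsUI [X in (_ + X)%N](_ : _ = 0%N) ?addn0; last first.
    apply/eqP; rewrite cards_eq0; apply/eqP/setP => w; rewrite strayE !inE.
    by case: (_ < _)%N; rewrite ?andbF.
  apply: eq_card => w; rewrite plE strayE !inE /sg.
  case: (rank_of b w < r0)%N => /=; last by rewrite !andbF /= andbT.
  by rewrite andbF orbF negb_and; case: [forall j, _] => //=; rewrite andbT.
have c3 : #|P1| = #|P2|.
  have fb w (w1 := flip (pred1 b) w) : w \in plain b -> w1 \in plain b.
    rewrite !inE => /forallP H; apply/forallP => j; apply/implyP => jb.
    have := H j; rewrite jb /= sg_flip // => /negPf->.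
    by rewrite /= ltn_eqF // andbF.
  have inj : injective (flip (pred1 b)) by apply: can_inj (@flip_flip _).
  rewrite -(card_imset (mem P1) inj); apply: eq_card => w.
  apply/imsetP/idP => [[w' + ->]|wP].
    rewrite inE => /andP[pl sgw]; rewrite inE fb // rank_of_flip // sg_flip //= eqxx sgw.
    by move: sgw => /andP[->].
  exists (flip (pred1 b) w); rewrite ?flip_flip //.
  move: wP; rewrite inE => /andP[pl /andP[lt nsg]].
  by rewrite inE fb // sg_flip // lt /= eqxx /= nsg.
lia.
Qed.

(** Each group multiplies the number of normal forms by half of one plus the stray proportion, which
    is at most [th]. *)
Lemma card_canon (R : realFieldType) (th : R) b : (b <= M)%N ->
  1 + (1 - (#|S| ^ wd)%:R ^-1) ^+ r0 <= 2 * th ->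
  #|canon b @: setT|%:R <= th ^+ b * #|{: Omega}|%:R.
Proof.
move=> bM thE; apply: (@le_trans _ _ #|plain b|%:R).
  rewrite ler_nat subset_leq_card //; apply/subsetP => _ /imsetP[w _ ->].
  exact: canon_plain.
have S0 : (0 < #|S|)%N by apply/card_gt0P; exists u.
have q0 : (0 : R) < (#|S| ^ wd)%:R by rewrite ltr0n expn_gt0 S0.
have q1 : (#|S| ^ wd)%:R ^-1 <= (1 : R) by rewrite invf_le1 // ler1n -(ltr0n R).
have th0 : 0 <= th.
  have : 0 <= (1 - (#|S| ^ wd)%:R ^-1) ^+ r0 :> R by rewrite exprn_ge0 // subr_ge0.
  lra.
elim: b bM => [|b IHb] bM; first by rewrite mul1r ler_nat max_card.
have := card_plainS bM => /(congr1 (fun k => k%:R : R)); rewrite natrM natrD => E.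
have := card_stray bM (leqnn r0).
rewrite -(ler_nat R) !natrM expnM natrX (natrX _ (_ - 1)) natrB ?expn_gt0 ?S0 // => stray_le.
have {}stray_le : #|stray b r0|%:R <= #|plain b|%:R * (1 - (#|S| ^ wd)%:R ^-1) ^+ r0 :> R.
  rewrite -(ler_pM2r (exprn_gt0 r0 q0)) (le_trans stray_le) //.
  by rewrite -mulrA -exprMn mulrBl mul1r mulVf ?gt_eqF.
have pl0 : 0 <= #|plain b|%:R :> R by [].
rewrite exprS -mulrA; apply: le_trans (_ : th * #|plain b|%:R <= _); last first.
  by rewrite ler_wpM2l // IHb // ltnW.
have : #|plain b|%:R * (1 + (1 - (#|S| ^ wd)%:R ^-1) ^+ r0) <= #|plain b|%:R * (2 * th) :> R.
  by rewrite ler_wpM2l.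
lra.
Qed.

End Flips.

(** * Polynomials of configurations: lacunary flips and counting on one interval *)

Lemma lacunary_sum_le (R : realFieldType) (lo hi : nat -> R) (M : nat) :
  (forall j, (j < M)%N -> 0 <= lo j <= hi j) ->
  (forall j, (j.+1 < M)%N -> 4 * hi j <= lo j.+1) ->
  forall j, (j < M)%N -> \sum_(i < j) hi i <= lo j / 2 /\ lo 0%N <= lo j.
Proof.
move=> lohi lac; elim=> [|j IHj] jM.
  by rewrite big_ord0 lexx; split=> //; have := lohi _ jM; lra.
have [IH1 IH2] := IHj (ltnW jM); rewrite big_ord_recr /=.
by have := lohi _ (ltnW jM); have := lac _ jM; lra.
Qed.

Definition near_double (R : rcfType) (p : {poly R}) (a b delta : R) : Prop :=
  exists x, [/\ a <= x <= b, p.[x] = 0 & `|p^`().[x]| <= delta].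

Section Pieces.
Variables (R : rcfType) (S : finType) (neg : S -> S) (u : S) (val : S -> R).
Hypotheses (negK : involutive neg) (neg_u : neg u != u).
Hypotheses (valN : forall a, val (neg a) = - val a) (val_u : val u = 1).
Variable n : nat.
Implicit Types (v : 'I_n.+1 -> bool) (w : {ffun 'I_n.+1 -> S}) (A : {set 'I_n.+1}).

(** The fixed signs [v] turn a block with a prescribed sign pattern into one with equal values,
    which is what alignment asks for. *)
Definition coef_poly v w : {poly R} :=
  \sum_(i < n.+1) ((-1) ^+ v i * val (w i)) *: 'X^i.
Definition sign_poly v A : {poly R} := \sum_(i in A) (-1) ^+ v i *: 'X^i.

Lemma size_coef_poly v w : (size (coef_poly v w) <= n.+1)%N.
Proof.
apply: (leq_trans (size_sum _ _ _)); apply/bigmax_leqP => i _; apply: leq_trans (size_scale_leq _ _) _.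
by rewrite size_polyXn.
Qed.

Variables (I : nat -> nat -> {set 'I_n.+1}) (M r0 wd : nat).
Hypothesis I_gt0 : forall j r, (j < M)%N -> (r < r0)%N -> I j r != set0.
Hypothesis I_card : forall j r, (j < M)%N -> (r < r0)%N -> (#|I j r| <= wd)%N.
Hypothesis I_disj : forall j r j' r' i, (j < M)%N -> (r < r0)%N ->
  (j' < M)%N -> (r' < r0)%N -> i \in I j r -> i \in I j' r' -> j = j' /\ r = r'.

Local Notation canon := (canon neg u I M r0).
Local Notation sel := (sel neg u I r0).
Local Notation sg := (sg neg u I r0).

(** A selected set of sign [true] has the values [-1], which [canon] turns into [1]; disjointness
    puts each index into at most one selected set. *)
Lemma coef_poly_canon v w b : (b <= M)%N ->
  coef_poly v w = coef_poly v (canon b w)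
    - 2 *: \sum_(j < b) (sg j w)%:R *: sign_poly v (sel j w).
Proof.
move=> bM; rewrite /coef_poly /sign_poly.
under [X in _ - 2 *: X]eq_bigr do rewrite big_mkcond /= scaler_sumr.
rewrite exchange_big /= scaler_sumr -sumrB; apply: eq_bigr => i _.
rewrite /canon ffunE.
have [|nex] := boolP [exists j : 'I_M, ((j < b)%N && sg j w) && (i \in sel j w)].
  case/existsP => j /andP[/andP[jb sj] ij].
  have lt : (rank_of neg u I r0 j w < r0)%N by have [] := mem_sel ij.
  rewrite (sel_value (I := I) lt ij) sj negK valN val_u.
  rewrite (bigD1 (Ordinal jb)) //= ij sj scale1r big1 ?addr0.
    by rewrite scalerA -scalerBl; congr (_ *: _); ring.
  move=> k kj; case: ifP => ik; last by rewrite scaler0.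
  suff kE : k = j :> nat by case/eqP: kj; apply/val_inj.
  have [lt' ik'] := mem_sel ik; have [_ ij'] := mem_sel ij.
  by have [] := I_disj (leq_trans (ltn_ord k) bM) lt' (ltn_ord j) lt ik' ij'.
rewrite big1 ?scaler0 ?subr0 // => j _; case: ifP => ij; last by rewrite scaler0.
case sj : (sg j w); last by rewrite scale0r.
case/negP: nex; apply/existsP; exists (widen_ord bM j).
by rewrite /= ltn_ord sj ij.
Qed.

(** The difference of the two values is [2] times a sum of block values with signs. If the signs
    differ, the highest differing group [m] outweighs the lower ones by lacunarity, so the
    difference is at least [lo m >= lo 0 > 2 s], whereas both values are at most [s]. *)
Lemma canon_inj_small v b x s (lo hi : nat -> R) : (0 < M)%N -> (b <= M)%N ->
  (forall j r, (j < M)%N -> (r < r0)%N ->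
     lo j <= `|(sign_poly v (I j r)).[x]| <= hi j) ->
  (forall j, (j < M)%N -> 0 <= lo j <= hi j) ->
  (forall j, (j.+1 < M)%N -> 4 * hi j <= lo j.+1) ->
  2 * s < lo 0%N ->
  forall w w', canon b w = canon b w' ->
    `|(coef_poly v w).[x]| <= s -> `|(coef_poly v w').[x]| <= s -> w = w'.
Proof.
move=> M0 bM bnd lohi lac slo w w' E Fw Fw'.
apply: (canon_inj negK I_disj E) => j jM jb; apply/eqP/negP => /negP sj.
have exj : exists k, (k < b)%N && (sg k w != sg k w') by exists j; rewrite jb.
have ubj k : (k < b)%N && (sg k w != sg k w') -> (k <= b)%N by move=> /andP[/ltnW].
case: (ex_maxnP exj ubj) => m /andP[mb sm] mmax {j jM jb sj exj ubj}.
have mM := leq_trans mb bM.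
have selE k : (k < b)%N -> sel k w = sel k w'.
  by move=> kb; apply: (canon_sel negK I_disj _ E); exact: leq_trans bM.
pose P k := (sign_poly v (sel k w)).[x].
pose d k : R := (sg k w)%:R - (sg k w')%:R.
have valE w0 : (coef_poly v w0).[x] = (coef_poly v (canon b w0)).[x]
    - 2 * \sum_(k < b) (sg k w0)%:R * (sign_poly v (sel k w0)).[x].
  rewrite {1}(coef_poly_canon v w0 bM) hornerD hornerN hornerZ.
  by congr (_ - _ * _); rewrite horner_sum; apply: eq_bigr => k _; rewrite hornerZ.
have FE : (coef_poly v w).[x] - (coef_poly v w').[x] = - 2 * \sum_(k < b) d k * P k.
  have -> : \sum_(k < b) d k * P k = \sum_(k < b) (sg k w)%:R * P k
      - \sum_(k < b) (sg k w')%:R * (sign_poly v (sel k w')).[x].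
    by rewrite -sumrB; apply: eq_bigr => i _; rewrite /d /P -selE // mulrBl.
  by rewrite (valE w) (valE w') E /P; ring.
have dP k : (k < b)%N -> d k != 0 -> `|d k| = 1 /\ lo k <= `|P k| <= hi k.
  move=> kb; rewrite /d /P => dk.
  have kM : (k < M)%N by apply: leq_trans bM.
  (* If no candidate is aligned in [w], the common selection is empty; as candidate sets are
     nonempty, none is aligned in [w'] either and [d k] vanishes. *)
  have lt : (rank_of neg u I r0 k w < r0)%N.
    have [|nlt] := boolP (rank_of neg u I r0 k w < r0)%N => //.
    have rkE : (rank_of neg u I r0 k w' < r0)%N = false.
      apply/negbTE/negP => lt'; case/set0Pn: (I_gt0 kM lt') => i.
      by have := selE k kb; rewrite /sel lt' (negPf nlt) => <-; rewrite inE.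
    by case/negP: dk; rewrite /sg rkE (negPf nlt) subrr.
  split; last by rewrite /sel lt; exact: bnd.
  by move: dk; case: (sg k w); case: (sg k w');
    rewrite /= ?mulr0n ?mulr1n ?subrr ?subr0 ?sub0r ?normrN ?normr1 ?eqxx.
have dm : d m != 0.
  by move: sm; rewrite /d; case: (sg m w); case: (sg m w');
    rewrite /= ?mulr0n ?mulr1n ?subrr ?subr0 ?sub0r ?oppr_eq0 ?oner_eq0 ?eqxx.
have hiP (k : 'I_m) : `|d k * P k| <= hi k.
  have kb : (k < b)%N by apply: ltn_trans mb.
  have [->|dk] := eqVneq (d k) 0.
    have /andP[] := lohi k (leq_trans kb bM).
    by rewrite mul0r normr0 => /le_trans; apply.
  by have [d1 /andP[_ hik]] := dP k kb dk; rewrite normrM d1 mul1r.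
have sumE : \sum_(k < b) d k * P k = \sum_(k < m) d k * P k + d m * P m.
  rewrite -(big_mkord xpredT (fun k => d k * P k)) (big_cat_nat (n := m.+1)) //=.
  rewrite [X in _ + X](_ : _ = 0) ?addr0; first by rewrite big_nat_recr //= big_mkord.
  rewrite big_nat big1 // => k /andP[mk kb].
  rewrite /d; have [/eqP->|sk] := boolP (sg k w == sg k w'); first by rewrite subrr mul0r.
  by have := mmax k; rewrite kb sk => /(_ isT); rewrite leqNgt mk.
have [d1 /andP[lom _]] := dP m mb dm.
have [lac1 lac2] := lacunary_sum_le lohi lac mM.
have low : lo m / 2 <= `|\sum_(k < b) d k * P k|.
  rewrite sumE addrC; apply: le_trans (lerB_normD _ _) => /=.
  rewrite [ `|d m * _| ]normrM d1 mul1r.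
  have : `|\sum_(k < m) d k * P k| <= \sum_(k < m) hi k.
    by apply: le_trans (ler_norm_sum _ _ _) _; exact: ler_sum.
  by move: lom lac1; lra.
have := ler_normB (coef_poly v w).[x] (coef_poly v w').[x].
rewrite FE normrM normrN (ger0_norm (ler0n _ 2)).
by move: low slo lac2 Fw Fw'; lra.
Qed.

Lemma coef_poly_twist v w :
  coef_poly (fun=> false) [ffun i => if v i then neg (w i) else w i] = coef_poly v w.
Proof.
apply: eq_bigr => i _; rewrite ffunE expr0 mul1r; congr (_ *: _).
by case: (v i); rewrite ?valN ?expr0 ?expr1 ?mulN1r ?mul1r.
Qed.

(** Negating the coefficients marked by [v] is an involution of the configurations. *)
Lemma card_twist v (P : {poly R} -> bool) :
  #|[set w | P (coef_poly (fun=> false) w)]| = #|[set w | P (coef_poly v w)]|.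
Proof.
pose tw w : {ffun 'I_n.+1 -> S} := [ffun i => if v i then neg (w i) else w i].
have twK : involutive tw.
  by move=> w; apply/ffunP => i; rewrite !ffunE; case: (v i); rewrite ?negK.
rewrite -(card_imset _ (inv_inj twK)); apply: eq_card => w; rewrite inE.
apply/imsetP/idP => [[w' + ->]|Pw].
  by rewrite inE -(coef_poly_twist v (tw w')) -/(tw (tw w')) twK.
by exists (tw w); rewrite ?twK // inE coef_poly_twist.
Qed.

(** Apply [card_near_double_roots] with [nu := canon b]: flipping only the low groups moves the
    derivative by at most [2 b dmax <= eta]. At a grid point all [M] groups can be used, whence
    [th ^+ M] there; the critical points depend on [canon b], whence [th ^+ b]. *)
Lemma card_near_double_piece v (b T : nat) (th a l delta eta s dmax : R)
    (lo hi : R -> nat -> R) :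
  (0 < M)%N -> (b <= M)%N -> 1 + (1 - (#|S| ^ wd)%:R ^-1) ^+ r0 <= 2 * th ->
  (0 < T)%N -> 0 <= l -> 0 <= delta -> 0 <= dmax ->
  2 * b%:R * dmax <= eta -> l * (delta + 2 * eta) <= s ->
  (forall x, a <= x <= a + T%:R * l ->
   [/\ forall j r, (j < M)%N -> (r < r0)%N ->
         lo x j <= `|(sign_poly v (I j r)).[x]| <= hi x j,
      forall j r, (j < b)%N -> (r < r0)%N -> `|(sign_poly v (I j r))^`().[x]| <= dmax,
      forall j, (j < M)%N -> 0 <= lo x j <= hi x j,
      forall j, (j.+1 < M)%N -> 4 * hi x j <= lo x j.+1
    & 2 * s < lo x 0%N]) ->
  #|[set w | `[< near_double (coef_poly (fun=> false) w) a (a + T%:R * l) delta >]]|%:R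
    <= (T%:R * th ^+ M + (n.*2 + 3)%:R * th ^+ b) * #|{: {ffun 'I_n.+1 -> S}}|%:R.
Proof.
move=> M0 bM thE T0 l0 d0 dm0 etaE sE H.
have eta0 : 0 <= eta by apply: le_trans etaE; rewrite !mulr_ge0.
have card b' : (b' <= M)%N ->
    #|canon b' @: setT|%:R <= th ^+ b' * #|{: {ffun 'I_n.+1 -> S}}|%:R.
  by move=> b'M; exact: (card_canon negK neg_u I_gt0 I_card I_disj).
have inj b' w w' x : (b' <= M)%N -> a <= x <= a + T%:R * l -> canon b' w = canon b' w' ->
    `|(coef_poly v w).[x]| <= s -> `|(coef_poly v w').[x]| <= s -> w = w'.
  by move=> b'M /H[h1 _ h3 h4 h5]; exact: (canon_inj_small (lo := lo x) (hi := hi x) M0 b'M h1 h3 h4 h5).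
rewrite (card_twist v (fun p => `[< near_double p a (a + T%:R * l) delta >])).
apply: (@le_trans _ _ (T * #|canon M @: setT| + #|canon b @: setT| * (n.*2 + 3))%:R).
  rewrite ler_nat.
  apply: (@card_near_double_roots _ _ (coef_poly v) (canon b) n T _ _ a l delta eta s) => //.
  - exact: size_coef_poly.
  - move=> w x /H[_ h2 _ _ _].
    rewrite (coef_poly_canon v w bM) derivB derivZ hornerD hornerN hornerZ addrAC subrr add0r.
    rewrite normrN normrM (raddf_sum (deriv (R := R))) horner_sum ger0_norm ?ler0n //.
    apply: le_trans etaE; rewrite -mulrA ler_wpM2l ?ler0n //.
    apply: le_trans (ler_norm_sum _ _ _) _.
    rewrite -[X in _ <= X%:R * _]card_ord mulr_natl -sumr_const; apply: ler_sum => j _.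
    rewrite /= derivZ hornerZ normrM ger0_norm ?ler0n //.
    case sj : (sg j w); last by rewrite mul0r.
    rewrite mul1r; move/andP: sj => [lt _]; rewrite /sel lt; exact: h2.
  - by move=> w w' x; exact: inj.
  - move=> x xI; rewrite -(card_in_imset (f := canon M)
      (D := [set w | `|(coef_poly v w).[x]| <= s])); last first.
      by move=> w w'; rewrite !inE => h h' E; exact: inj E h h'.
    by apply: subset_leq_card; apply/subsetP => _ /imsetP[w _ ->]; rewrite imset_f.
rewrite natrD !natrM mulrDl lerD //.
  by rewrite -mulrA ler_wpM2l ?ler0n // card.
by rewrite mulrC -mulrA ler_wpM2l ?ler0n // card.
Qed.
End Pieces.

(** * Roots away from 1 *)

Section Bernoulli.
Variable R : realFieldType.

Lemma bernoulli_ineq (y : R) m : -1 <= y -> 1 + m%:R * y <= (1 + y) ^+ m.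
Proof.
move=> y1; elim: m => [|m IHm]; first by rewrite mul0r addr0.
rewrite exprS -natr1; apply: (@le_trans _ _ ((1 + y) * (1 + m%:R * y))).
  have : 0 <= m%:R * (y * y) by rewrite mulr_ge0 ?ler0n // -expr2 sqr_ge0.
  lra.
by rewrite ler_wpM2l //; lra.
Qed.

(** With [z = 1 / m], Bernoulli gives [(1 + z)^m >= 2], while [y (1 + z) <= 1 - z^2 <= 1]. *)
Lemma exprn_le_half (y : R) m : (0 < m)%N -> 0 <= y <= 1 - m%:R^-1 -> y ^+ m <= 2^-1.
Proof.
move=> m0 /andP[y0 y1]; have m0R : 0 < m%:R :> R by rewrite ltr0n.
set z := m%:R^-1 in y1; have z0 : 0 < z by rewrite invr_gt0.
have two : 2 <= (1 + z) ^+ m.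
  apply: le_trans (bernoulli_ineq _ _); last by lra.
  by rewrite /z mulfV ?gt_eqF //; lra.
have : (y * (1 + z)) ^+ m <= 1.
  by rewrite exprn_ile1 ?mulr_ge0 //; nra.
have : y ^+ m * 2 <= y ^+ m * (1 + z) ^+ m by rewrite ler_wpM2l ?exprn_ge0.
by rewrite exprMn; lra.
Qed.
End Bernoulli.

Section ZoneOne.
Variables (R : rcfType) (S : finType) (neg : S -> S) (u : S) (val : S -> R).
Hypotheses (negK : involutive neg) (neg_u : neg u != u).
Hypotheses (valN : forall a, val (neg a) = - val a) (val_u : val u = 1).
Variables n c : nat.

(* Single coefficients at the multiples of [k], where [beta ^ k] is about 1/4. *)
Lemma card_near_double_inner (H M b : nat) (alpha lam beta delta : R) :
  (0 < c)%N -> (0 < M)%N -> (b <= M)%N -> (0 < H)%N -> (2 * H * M <= n)%N ->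
  0 < lam <= 1 -> beta = alpha + lam ->
  c%:R^-1 <= alpha -> beta <= 1 - H%:R^-1 ->
  c%:R * n%:R * lam <= 2^-1 ->
  0 <= delta <= (4 * c)%:R ^- M ->
  #|[set w | `[< near_double (coef_poly (n := n) val (fun=> false) w) alpha beta delta >]]|%:R
    <= ((48 * n ^ 2 * (4 * c) ^ b)%:R * (1 - (2 * #|S|)%:R^-1) ^+ M
       + (n.*2 + 3)%:R * (1 - (2 * #|S|)%:R^-1) ^+ b) * #|{: {ffun 'I_n.+1 -> S}}|%:R :> R.
Proof.
move=> c0 M0 bM H0 HMn /andP[lam0 lam1] betaE calpha beta1 lamn /andP[d0 dM].
have c0R : 0 < c%:R :> R by rewrite ltr0n.
have alpha0 : 0 < alpha by apply: lt_le_trans calpha; rewrite invr_gt0.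
have H0R : 0 < H%:R^-1 :> R by rewrite invr_gt0 ltr0n.
have ab : alpha <= beta by lra.
have beta0 : 0 < beta by lra.
have beta_lt1 : beta <= 1 by lra.
have exk : exists k, beta ^+ k <= 4^-1.
  exists (2 * H)%N; rewrite mulnC exprM.
  have h : beta ^+ H <= 2^-1 by apply: exprn_le_half => //; rewrite beta1 ltW.
  have := @ler_pM _ _ _ _ _ (exprn_ge0 H (ltW beta0)) (exprn_ge0 H (ltW beta0)) h h.
  by rewrite expr2; lra.
case: (ex_minnP exk) => k kP kmin.
have kH : (k <= 2 * H)%N.
  apply: kmin; rewrite mulnC exprM.
  have h : beta ^+ H <= 2^-1 by apply: exprn_le_half => //; rewrite beta1 ltW.
  have := @ler_pM _ _ _ _ _ (exprn_ge0 H (ltW beta0)) (exprn_ge0 H (ltW beta0)) h h.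
  by rewrite expr2; lra.
have k0 : (0 < k)%N by case: k kP {kmin kH} => //; rewrite expr0; lra.
(* Minimality of [k] gives [beta ^+ k.-1 > 1 / 4], and one more factor costs at most [c]. *)
have betak : (4 * c)%:R^-1 <= beta ^+ k.
  case: k k0 kmin {kP kH} => // k _ kmin.
  have : 4^-1 < beta ^+ k by rewrite ltNge; apply/negP => /kmin; rewrite ltnn.
  rewrite exprS natrM invfM => h; rewrite mulrC ler_pM ?invr_ge0 ?ler0n //; last exact: ltW.
  exact: le_trans calpha ab.
have kMn e : (e <= M)%N -> (k * e <= n)%N.
  by move=> eM; apply: leq_trans HMn; rewrite leq_mul.
(* The piece is so short that powers with exponent at most [n] vary on it by a factor of at most
   2. *)
have half e : (e <= n)%N -> beta ^+ e / 2 <= alpha ^+ e.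
  move=> en.
  have r0 : 0 <= c%:R * lam by rewrite mulr_ge0 ?ler0n // ltW.
  have n1 : (0 < n)%N.
    by apply: leq_trans HMn; rewrite !muln_gt0 H0 M0.
  have r1 : c%:R * lam <= 1.
    apply: le_trans (_ : c%:R * n%:R * lam <= _); last lra.
    by rewrite mulrAC ler_peMr // ler1n.
  have : beta * (1 - c%:R * lam) <= alpha.
    have : 1 <= c%:R * alpha by rewrite mulrC -ler_pdivrMr // mul1r.
    by rewrite betaE; nra.
  move=> h; apply: (@le_trans _ _ ((beta * (1 - c%:R * lam)) ^+ e)); last first.
    by apply: lerXn2r => //; rewrite nnegrE ?mulr_ge0 ?subr_ge0 // ltW.
  rewrite exprMn ler_wpM2l ?exprn_ge0 ?(ltW beta0) //.
  apply: le_trans (bernoulli_ineq _ _); last by lra.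
  have : e%:R * (c%:R * lam) <= n%:R * (c%:R * lam) by rewrite ler_wpM2r // ler_nat.
  by move: lamn; lra.
(* Exponents decrease in [j], so that the values [x ^+ pos j] increase, by factors of at least 4
   since [x ^+ k <= 1 / 4]. *)
pose pos j := (k * (M - j))%N.
pose I j (r : nat) : {set 'I_n.+1} := [set inord (pos j)].
have posn j : (pos j < n.+1)%N by rewrite ltnS kMn // leq_subr.
have spE j r : sign_poly R (fun=> false) (I j r) = 'X^(pos j).
  by rewrite /sign_poly big_set1 scale1r inordK.
(* [T] makes [l * (3 * eta) <= beta ^+ (k * M) / 8]: here [48 = 8 * 3 * 2], [eta] is [2 n^2] times
   [beta ^+ (k * (M - b))], and [(4 * c) ^ b] pays for [beta ^+ (k * b)]. *)
pose T := (48 * n ^ 2 * (4 * c) ^ b)%N.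
have n0 : (0 < n)%N by apply: leq_trans HMn; rewrite !muln_gt0 H0 M0.
have T0 : (0 < T)%N by rewrite !muln_gt0 ?expn_gt0 ?n0 ?muln_gt0 ?c0.
pose l := lam / T%:R.
have bE : beta = alpha + T%:R * l by rewrite /l mulrC divfK ?pnatr_eq0 -?lt0n.
rewrite bE -/T.
pose dmax := n%:R * beta ^+ (k * (M - b)).
pose eta := 2 * n%:R * dmax.
have bn : (b <= n)%N by apply: leq_trans bM _; apply: leq_trans (kMn M (leqnn _)); rewrite leq_pmull.
have dmax0 : 0 <= dmax by rewrite mulr_ge0 ?exprn_ge0 // ltW.
(* With one candidate of one coefficient per group, [th = 1 - 1 / (2 #|S|)] is exactly the average
   in [card_canon]. The threshold [beta ^+ (k * M) / 8] is below half of the smallest block value,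
   which is at least [beta ^+ (k * M) / 2]. *)
apply: (@card_near_double_piece R S neg u val negK neg_u valN val_u n I M 1 1 _ _ _
  (fun=> false) b T _ alpha l delta eta (beta ^+ (k * M) / 8) dmax
  (fun x j => x ^+ pos j) (fun x j => x ^+ pos j)) => //.
- by move=> j r _ _; rewrite /I; apply/set0Pn; exists (inord (pos j)); rewrite inE.
- by move=> j r _ _; rewrite /I cards1.
- move=> j r j' r' i jM r1 j'M r'1; rewrite !inE => /eqP-> /eqP/(congr1 (@nat_of_ord _))/=.
  rewrite !inordK // /pos => /eqP; rewrite eqn_pmul2l // => /eqP.
  by move: jM j'M r1 r'1; clear; lia.
- rewrite expr1 expn1 natrM invfM; lra.
- by rewrite divr_ge0 // ltW.
- by rewrite /eta !ler_wpM2r // ler_wpM2l // ler_nat.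
- have delta_eta : delta <= eta.
    apply: le_trans dM _; rewrite -exprVn.
    apply: (@le_trans _ _ (beta ^+ (k * M))).
      by rewrite exprM lerXn2r ?nnegrE ?invr_ge0 ?exprn_ge0 ?(ltW beta0).
    rewrite /eta /dmax mulrA -{1}[_ ^+ _]mul1r ler_pM ?exprn_ge0 ?(ltW beta0) //.
      by rewrite -natrM -natrM ler1n muln_gt0 n0 muln_gt0 n0.
    by rewrite ler_wiXn2l ?(ltW beta0) // leq_mul // leq_subr.
  apply: (@le_trans _ _ (l * (3 * eta))).
    by rewrite ler_wpM2l ?divr_ge0 ?(ltW lam0) //; lra.
  have -> : (k * M = k * (M - b) + k * b)%N by rewrite -mulnDr subnK.
  rewrite exprD /eta /dmax.
  set z := beta ^+ (k * (M - b)).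
  have z0 : 0 <= z by rewrite exprn_ge0 // ltW.
  have : l * (48 * n%:R ^+ 2) <= beta ^+ (k * b).
    apply: (@le_trans _ _ ((4 * c)%:R ^- b)); last first.
      by rewrite -exprVn exprM lerXn2r ?nnegrE ?invr_ge0 ?exprn_ge0 ?(ltW beta0).
    rewrite /l mulrAC ler_pdivrMr ?ltr0n // /T (natrM _ (48 * n ^ 2)) (natrM _ 48) !natrX.
    rewrite [X in _ <= X]mulrCA mulVf ?mulr1; last by rewrite expf_neq0 // pnatr_eq0 muln_eq0 -lt0n.
    by rewrite ler_piMl // mulr_ge0 // exprn_ge0.
  by move=> h; have := ler_wpM2l z0 h; lra.
move=> x /andP[ax]; rewrite -bE => xb.
have x0 : 0 < x by apply: lt_le_trans ax.
have x1 : x <= 1 by apply: le_trans xb _.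
have xk : x ^+ k <= 4^-1 by apply: le_trans kP; apply: lerXn2r => //; rewrite nnegrE ltW.
split.
- by move=> j r _ _; rewrite spE hornerXn ger0_norm ?lexx // exprn_ge0 // ltW.
- move=> j r jb _; rewrite spE derivXn hornerMn hornerXn -mulr_natl.
  rewrite ger0_norm ?mulr_ge0 ?exprn_ge0 ?(ltW x0) //.
  rewrite ler_pM ?exprn_ge0 ?(ltW x0) //; first by rewrite ler_nat -ltnS.
  apply: (@le_trans _ _ (beta ^+ (pos j).-1)).
    by apply: lerXn2r => //; rewrite nnegrE ltW.
  rewrite ler_wiXn2l ?(ltW beta0) // /pos.
  have : (k * (M - b) + k <= k * (M - j))%N.
    by rewrite -mulnSr leq_mul // ltn_sub2l // (leq_trans jb).
  by move: (k * (M - b))%N (k * (M - j))%N k0; clear; lia.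
- by move=> j _; rewrite exprn_ge0 ?lexx // ltW.
- move=> j jM; rewrite {1}/pos -subnSK; last exact: ltnW.
  rewrite mulnS exprD -/(pos j.+1); have : 0 <= x ^+ pos j.+1 by rewrite exprn_ge0 // ltW.
  by move: xk; nra.
rewrite /pos subn0.
have h : beta ^+ (k * M) / 2 <= x ^+ (k * M).
  apply: le_trans (half _ (kMn M (leqnn _))) _.
  by apply: lerXn2r => //; rewrite nnegrE ltW.
have : 0 < beta ^+ (k * M) by rewrite exprn_gt0.
lra.
Qed.
End ZoneOne.

(** * Thue-Morse polynomials and roots near 1 *)

(** For [t < 2 ^ K] this is the parity of the binary digit sum of [t]. *)
Fixpoint thue_morse K t := if K is K'.+1 then
  if (t < 2 ^ K')%N then thue_morse K' t else ~~ thue_morse K' (t - 2 ^ K')%N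
  else false.

Definition thue_morse_poly (R : nzRingType) K L : {poly R} :=
  \prod_(i < K) (1 - 'X^(2 ^ i * L)).

(** The last factor appends a second half of the sequence with all signs reversed. *)
Lemma thue_morse_polyE (R : comNzRingType) K L : thue_morse_poly R K L =
  \sum_(0 <= t < 2 ^ K) (-1) ^+ thue_morse K t *: 'X^(L * t).
Proof.
elim: K => [|K IHK].
  by rewrite /thue_morse_poly big_ord0 expn0 big_nat1 /= muln0 scale1r.
have le2 : (2 ^ K <= 2 ^ K.+1)%N by rewrite leq_exp2l.
rewrite [RHS](big_cat_nat (n := 2 ^ K)) //=.
rewrite {1}/thue_morse_poly big_ord_recr /= -/(thue_morse_poly R K L) IHK mulrBr mulr1.
congr (_ + _); first by apply: eq_big_nat => t /andP[_ ->].
symmetry; rewrite -[X in index_iota X]add0n big_addn expnS mul2n -addnn addnK.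
rewrite mulr_suml -sumrN; apply: eq_big_nat => t /andP[_ tK].
rewrite -scalerAl -scaleNr -exprD addnK ifF ?ltnNge ?leq_addl //.
by rewrite mulnDr [(L * 2 ^ K)%N]mulnC; case: thue_morse; rewrite /= ?expr0 ?expr1 ?opprK.
Qed.

Section ThueMorseBounds.
Variable R : realFieldType.
Implicit Types (x y : R).

Lemma one_subX_le x m : 0 <= x <= 1 -> 1 - x ^+ m <= m%:R * (1 - x).
Proof.
move=> /andP[x0 x1]; have := @bernoulli_ineq R (x - 1) m.
by rewrite [1 + (x - 1)]addrC subrK => /(_ _); lra.
Qed.

Lemma one_subX_ge x m : 0 <= x <= 1 -> m%:R * (1 - x) * (1 - m%:R * (1 - x)) <= 1 - x ^+ m.
Proof.
move=> /andP[x0 x1].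
have h : 1 - m%:R * (1 - x) <= x ^+ m by have := @one_subX_le x m; rewrite x0 x1 => /(_ isT); lra.
have m0 : 0 <= m%:R * (1 - x) by rewrite mulr_ge0 // subr_ge0.
apply: (@le_trans _ _ (m%:R * (1 - x) * x ^+ m)); first by rewrite ler_wpM2l.
have -> : 1 - x ^+ m = (1 - x) * \sum_(i < m) x ^+ i.
  by rewrite -[in LHS](expr1n _ m) subrXX; congr (_ * _); apply: eq_bigr => i _; rewrite expr1n mul1r.
rewrite [m%:R * _]mulrC -mulrA ler_wpM2l ?subr_ge0 //.
rewrite -[X in X%:R * _]card_ord mulr_natl -sumr_const; apply: ler_sum => i _.
by rewrite ler_wiXn2l // ltnW.
Qed.

Lemma thue_morse_poly_ge0 K L x : 0 <= x <= 1 -> 0 <= (thue_morse_poly R K L).[x].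
Proof.
move=> /andP[x0 x1]; rewrite horner_prod prodr_ge0 // => i _.
by rewrite !hornerE subr_ge0 exprn_ile1.
Qed.

(** This bounds the logarithmic derivative by [K m / (1 - x)]: a factor [1 - x^e] contributes
    [e x^(e-1) / (1 - x^e)], and [x^(e-1) (1 - x) <= 1 - x^e]. The form without division covers
    [x = 1]. *)
Lemma thue_morse_deriv_le K L m x : 0 <= x <= 1 -> (2 ^ K * L <= m)%N ->
  `|(thue_morse_poly R K L)^`().[x]| * (1 - x) <= (K * m)%:R * (thue_morse_poly R K L).[x].
Proof.
move=> xI; have /andP[x0 x1] := xI; elim: K => [|K IHK] Km.
  by rewrite /thue_morse_poly big_ord0 derivC hornerC normr0 mul0r mul0n mul0r.
have Km' : (2 ^ K * L <= m)%N by apply: leq_trans Km; rewrite leq_mul // leq_exp2l.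
have {}IHK := IHK Km'.
have p0 := thue_morse_poly_ge0 K L xI.
move: IHK p0; rewrite /thue_morse_poly big_ord_recr /= -/(thue_morse_poly R K L).
set p := thue_morse_poly R K L => IHK p0.
rewrite derivM derivB derivC derivXn sub0r !hornerE hornerMn hornerXn.
move: (2 ^ K * L)%N Km' => e em; set q := x ^+ e.
have q1 : q <= 1 by rewrite exprn_ile1.
have e0 : 0 <= x ^+ e.-1 by rewrite exprn_ge0.
have key : x ^+ e.-1 *+ e * (1 - x) <= m%:R * (1 - q).
  rewrite -mulr_natl /q; case: e em {q1 q e0} => [|e] em.
    by rewrite mul0r mul0r mulr_ge0 // subr_ge0 exprn_ile1.
  rewrite -mulrA ler_pM ?mulr_ge0 ?exprn_ge0 ?subr_ge0 ?ler_nat //=.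
  by rewrite exprS; have : x ^+ e <= 1 by [rewrite exprn_ile1]; nra.
apply: (@le_trans _ _ (`|p^`().[x]| * (1 - x) * (1 - q) + p.[x] * (x ^+ e.-1 *+ e * (1 - x)))).
  rewrite [X in _ <= X + _]mulrAC mulrA -mulrDl ler_wpM2r ?subr_ge0 //.
  apply: le_trans (ler_normD _ _) _; rewrite lerD //.
    by rewrite normrM [ `|1 - q|]ger0_norm ?subr_ge0.
  by rewrite normrM normrN (ger0_norm p0) ler_wpM2l // ger0_norm // mulrn_wge0.
have q1' : 0 <= 1 - q by rewrite subr_ge0.
have := ler_wpM2r q1' IHK; have := ler_wpM2l p0 key; rewrite mulSn natrD /= => h1 h2.
rewrite mulrDl mulrDl addrC lerD // (le_trans h1) //.
by rewrite mulrCA mulrA.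
Qed.

Lemma thue_morse_poly_le K L x : 0 <= x <= 1 ->
  (thue_morse_poly R K L).[x] <= \prod_(i < K) ((2 ^ i * L)%:R * (1 - x)).
Proof.
move=> xI; have /andP[x0 x1] := xI; rewrite horner_prod ler_prod // => i _.
by rewrite !hornerE one_subX_le // subr_ge0 exprn_ile1.
Qed.

Lemma thue_morse_poly_ge K L x : 0 <= x <= 1 -> (2 ^ K * L)%:R * (1 - x) <= 2^-1 ->
  \prod_(i < K) ((2 ^ i * L)%:R * (1 - x) / 2) <= (thue_morse_poly R K L).[x].
Proof.
move=> xI xK; have /andP[x0 x1] := xI; rewrite horner_prod ler_prod // => i _.
have z0 : 0 <= (2 ^ i * L)%:R * (1 - x) by rewrite mulr_ge0 // subr_ge0.
have z1 : (2 ^ i * L)%:R * (1 - x) <= 2^-1.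
  apply: le_trans xK; rewrite ler_wpM2r ?subr_ge0 // ler_nat leq_mul //.
  by rewrite leq_exp2l // ltnW.
rewrite !hornerE divr_ge0 //=; apply: le_trans (one_subX_ge (2 ^ i * L) xI).
by rewrite ler_wpM2l //; lra.
Qed.

(** In first order each factor grows by [1 + 1 / (2 D)]; for [x] this close to 1 the second-order
    error leaves at least [c = 1 + 1 / (4 D)]. Bernoulli gives [c ^+ (4 * D) >= 2], so [12 D]
    factors gain [8]. *)
Lemma thue_morse_poly_ratio D L L' x : (0 < D)%N -> 0 <= x <= 1 ->
  ((2 * D + 1) * L <= 2 * D * L')%N ->
  (8 * D * 2 ^ (12 * D) * L')%:R * (1 - x) <= 1 ->
  8 * (thue_morse_poly R (12 * D) L).[x] <= (thue_morse_poly R (12 * D) L').[x].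
Proof.
move=> D0 xI LL xL; have /andP[x0 x1] := xI.
have D0R : 0 < D%:R :> R by rewrite ltr0n.
pose c : R := 1 + (4 * D)%:R^-1.
have c4 : 2 <= c ^+ (4 * D).
  apply: le_trans (bernoulli_ineq _ _); first by rewrite mulfV ?pnatr_eq0 ?muln_eq0 -?lt0n //; lra.
  by have : 0 <= (4 * D)%:R^-1 :> R; [rewrite invr_ge0|lra].
have c12 : 8 <= c ^+ (12 * D).
  rewrite (_ : 12 * D = 4 * D * 3)%N; last by clear; lia.
  rewrite exprM; have : 2 ^+ 3 <= (c ^+ (4 * D)) ^+ 3.
    by apply: lerXn2r; rewrite ?nnegrE //; apply: le_trans c4.
  lra.
apply: (@le_trans _ _ (c ^+ (12 * D) * (thue_morse_poly R (12 * D) L).[x])).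
  by rewrite ler_wpM2r ?thue_morse_poly_ge0.
rewrite !horner_prod -[X in c ^+ X]card_ord -prodr_const -big_split /=.
have c0 : 0 <= c by rewrite addr_ge0 // invr_ge0.
apply: ler_prod => i _; rewrite !hornerE mulr_ge0 ?subr_ge0 ?exprn_ile1 //=.
set m := (2 ^ i * L)%N; set m' := (2 ^ i * L')%N.
apply: (@le_trans _ _ (c * (m%:R * (1 - x)))); first by rewrite ler_wpM2l // one_subX_le.
apply: le_trans (one_subX_ge m' xI).
have y0 : 0 <= 1 - x by rewrite subr_ge0.
have mm : (2 * D%:R + 1) * m%:R <= 2 * D%:R * m'%:R :> R.
  rewrite -[2]/(2%:R) -natrM -[1]/(1%:R) -natrD -!natrM ler_nat /m /m'.
  by rewrite mulnCA [X in (_ <= X)%N]mulnCA leq_mul.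
have m'x : 8 * D%:R * (m'%:R * (1 - x)) <= 1.
  apply: le_trans xL; rewrite mulrA ler_wpM2r // -natrM -natrM ler_nat -!mulnA.
  by rewrite leq_mul // leq_mul // leq_mul // leq_exp2l // ltnW.
have cD : c = 1 + 4^-1 / D%:R by rewrite /c natrM invfM.
have t0 : 0 <= m'%:R * (1 - x) by rewrite mulr_ge0.
have ab := ler_wpM2r y0 mm; rewrite -!mulrA in ab; rewrite cD.
move: (m%:R * (1 - x)) (m'%:R * (1 - x)) t0 m'x ab => a b b0 b1 ab.
have D1 : 1 <= D%:R :> R by rewrite ler1n.
move: (D%:R : R) D1 D0R b1 ab => d d1 d0 b1 ab.
have -> : (1 + 4^-1 / d) * a = (4 * d + 1) * a / (4 * d) by field; rewrite gt_eqF.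
rewrite ler_pdivrMr ?mulr_gt0 //.
have b2 : (4 * d + 2) * b <= 1 by nra.
have d2 : 0 < 2 * d + 1 by lra.
rewrite -(ler_pM2r d2).
apply: (@le_trans _ _ ((4 * d + 1) * (2 * d * b))).
  have : 0 <= (4 * d + 1) * (2 * (d * b) - (2 * d + 1) * a).
    by rewrite mulr_ge0 ?subr_ge0 //; lra.
  lra.
have db : 0 <= d * b by rewrite mulr_ge0 // ltW.
rewrite -subr_ge0 [X in 0 <= X](_ : _ = 2 * (d * b * (1 - (4 * d + 2) * b))); last by ring.
by rewrite mulr_ge0 // mulr_ge0 // subr_ge0.
Qed.
End ThueMorseBounds.

Section ZoneTwo.
Variables (R : rcfType) (S : finType) (neg : S -> S) (u : S) (val : S -> R).
Hypotheses (negK : involutive neg) (neg_u : neg u != u).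
Hypotheses (valN : forall a, val (neg a) = - val a) (val_u : val u = 1).
Variable n : nat.

(* Progressions [a + L t], [t < 2 ^ K], signed by the Thue-Morse sequence give
   [x^a prod_i (1 - x^(2^i L))], which is about [(1 - x)^K L^K]: letting [L] run through
   the integers [2^e (D + t)] with [K = 12 D] makes these values lacunary. *)
Lemma card_near_double_outer (D E E2 Lam : nat) (K := (12 * D)%N)
    (W := (D * 2 ^ E * 2 ^ K)%N) (r0 := (#|S| ^ (2 ^ K))%N) (alpha lam beta h delta : R) :
  (0 < D)%N -> (0 < E2)%N -> (E2 <= E)%N -> (D * E * r0 * W <= n)%N ->
  Lam%:R * lam = 1 -> beta = alpha + lam -> 0 <= alpha -> lam <= 1 - beta ->
  1 - alpha <= h -> (8 * D)%:R * (D * E * r0 * W)%:R * h <= 1 ->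
  0 <= delta <= Lam%:R ^- K ->
  #|[set w | `[< near_double (coef_poly (n := n) val (fun=> false) w) alpha beta delta >]]|%:R
    <= ((48 * K.+1 * n ^ 2 * 2 ^ (K * (E2 + 2)))%:R * (3 / 4) ^+ (D * E)
       + (n.*2 + 3)%:R * (3 / 4) ^+ (D * E2)) * #|{: {ffun 'I_n.+1 -> S}}|%:R :> R.
Proof.
move=> D0 E20 E2E Wn Lam1 betaE alpha0 lamb alphah h1 /andP[d0 dL].
have S0 : (0 < #|S|)%N by apply/card_gt0P; exists u.
have r00 : (0 < r0)%N by rewrite expn_gt0 S0.
have E0 : (0 < E)%N by apply: leq_trans E2E.
have K2 : (0 < 2 ^ K)%N by rewrite expn_gt0.
have W0 : (0 < W)%N by rewrite !muln_gt0 D0 K2 expn_gt0.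
set M := (D * E)%N; have M0 : (0 < M)%N by rewrite muln_gt0 D0.
have Lam0 : (0 < Lam)%N by rewrite lt0n; apply/eqP => L0; move: Lam1; rewrite L0 mul0r; lra.
have Lam0R : 0 < Lam%:R :> R by rewrite ltr0n.
have lam0 : 0 < lam by rewrite -(pmulr_rgt0 lam Lam0R) Lam1.
pose lag j := (2 ^ (j %/ D) * (D + j %% D))%N.
have lag_gt0 j : (0 < lag j)%N by rewrite muln_gt0 expn_gt0 addn_gt0 D0.
have lag_lt j e : (j < D * e)%N -> (lag j <= 2 ^ e * D)%N.
  move=> je; have jDe : (j %/ D < e)%N by rewrite ltn_divLR // mulnC.
  have jD : (j %% D < D)%N by rewrite ltn_mod.
  apply: (@leq_trans (2 ^ (j %/ D) * (2 * D))); first by rewrite leq_mul // mul2n -addnn leq_add2l ltnW.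
  by rewrite mulnA -expnSr leq_mul // leq_exp2l.
(* Within an octave [D + r] grows by one, and [2 D - 1] is followed by [2 D] in the next octave;
   both ratios exceed [1 + 1 / (2 D)]. *)
have lag_step j : ((2 * D + 1) * lag j <= 2 * D * lag j.+1)%N.
  have [jD|jD] := ltnP (j %% D).+1 D.
    have E1 : (j.+1 %/ D = j %/ D /\ j.+1 %% D = (j %% D).+1)%N.
      have -> : j.+1 = (j %/ D * D + (j %% D).+1)%N by rewrite addnS -divn_eq.
      by split; [rewrite divnMDl // (divn_small jD) addn0|rewrite modnMDl (modn_small jD)].
    rewrite /lag E1.1 E1.2; move: (j %/ D)%N (j %% D)%N jD => q r rD.
    rewrite mulnCA [X in (_ <= X)%N]mulnCA leq_mul //; move: rD; clear; nia.
  have jDE : (j %% D).+1 = D by apply/eqP; rewrite eqn_leq jD ltn_mod D0.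
  have E1 : (j.+1 %/ D = (j %/ D).+1 /\ j.+1 %% D = 0)%N.
    have -> : j.+1 = ((j %/ D).+1 * D)%N by rewrite {1}(divn_eq j D) -addnS jDE mulSn addnC.
    by rewrite mulnK // modnMl.
  rewrite /lag E1.1 E1.2 addn0 expnS.
  have -> : (2 * D * (2 * 2 ^ (j %/ D) * D) = 2 ^ (j %/ D) * (4 * D * D))%N by clear; lia.
  rewrite mulnCA leq_mul //; move: (j %% D)%N jDE => r; clear; nia.
(* Each pair [(j, r)] owns a window of [W] consecutive coefficients; [lagW] says that its
   progression fits. *)
pose start j r := ((j * r0 + r) * W)%N.
pose pos j r t := (start j r + lag j * t)%N.
have lagW j t : (j < M)%N -> (t < 2 ^ K)%N -> (lag j * t < W)%N.
  move=> jM tK; apply: (@leq_ltn_trans (2 ^ E * D * t)); first by rewrite leq_mul // lag_lt.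
  by rewrite /W [(D * _)%N]mulnC ltn_pmul2l // muln_gt0 expn_gt0.
have jr j r : (j < M)%N -> (r < r0)%N -> (j * r0 + r < M * r0)%N.
  move=> jM rr; apply: (@leq_trans (j.+1 * r0)); last by rewrite leq_mul2r jM orbT.
  by rewrite mulSn addnC ltn_add2r.
have posn' j r t : (j < M)%N -> (r < r0)%N -> (t < 2 ^ K)%N -> (pos j r t < M * r0 * W)%N.
  move=> jM rr tK; apply: (@leq_trans ((j * r0 + r).+1 * W)); last by rewrite leq_mul2r jr ?orbT.
  by rewrite mulSn [X in (_ < X)%N]addnC /pos ltn_add2l lagW.
have posn j r t : (j < M)%N -> (r < r0)%N -> (t < 2 ^ K)%N -> (pos j r t < n.+1)%N.
  by move=> jM rr tK; apply: leq_trans (posn' j r t jM rr tK) _; rewrite ltnW.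
pose I j r : {set 'I_n.+1} := [set inord (pos j r t) | t : 'I_(2 ^ K)].
(* The sign at a position is read off by decoding [j] and [t] through divisions; [decode] shows that
   this is right on every block. *)
pose v (i : 'I_n.+1) := thue_morse K ((i %% W) %/ lag (i %/ W %/ r0))%N.
have decode j r t : (j < M)%N -> (r < r0)%N -> (t < 2 ^ K)%N ->
    [/\ pos j r t %/ W %/ r0 = j, (pos j r t %/ W) %% r0 = r & (pos j r t %% W) %/ lag j = t]%N.
  move=> jM rr tK; have lW := lagW _ _ jM tK.
  have -> : (pos j r t %/ W = j * r0 + r)%N by rewrite /pos /start divnMDl // (divn_small lW) addn0.
  have -> : (pos j r t %% W = lag j * t)%N by rewrite /pos /start modnMDl (modn_small lW).
  by rewrite divnMDl // modnMDl (divn_small rr) (modn_small rr) addn0 mulKn.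
have I_inj j r : (j < M)%N -> (r < r0)%N -> injective (fun t : 'I_(2 ^ K) => inord (pos j r t) : 'I_n.+1).
  move=> jM rr t t' /(congr1 (@nat_of_ord _)); rewrite !inordK ?posn // => E'.
  have [_ _ tE] := decode _ _ _ jM rr (ltn_ord t).
  by have [_ _] := decode _ _ _ jM rr (ltn_ord t'); rewrite -E' tE => /val_inj.
have spE j r : (j < M)%N -> (r < r0)%N ->
    sign_poly R v (I j r) = 'X^(start j r) * thue_morse_poly R K (lag j).
  move=> jM rr; rewrite /sign_poly /I big_imset /=; last by move=> t t' _ _; exact: I_inj.
  rewrite thue_morse_polyE big_mkord mulr_sumr; apply: eq_bigr => t _.
  rewrite /v !inordK ?posn //; have [-> _ ->] := decode _ _ _ jM rr (ltn_ord t).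
  by rewrite -scalerAr -exprD.
have tDE : (M * r0 * W)%:R * (8 * D%:R) * h <= 1.
  by move: h1; rewrite natrM [8 * _]mulrC [_ * 8]mulrC [X in X * h <= _]mulrC.
have WMrW : (W <= M * r0 * W)%N by rewrite leq_pmull // muln_gt0 M0.
have D1 : 1 <= D%:R :> R by rewrite ler1n.
have lag2 j : (j < M)%N -> (2 ^ K * lag j <= W)%N.
  by move=> jM; rewrite /W mulnC leq_mul // mulnC lag_lt.
have b1 : beta <= 1 - lam by lra.
have ab : alpha <= beta by lra.
have h0 : 0 <= h by lra.
(* [P] is the first-order value at [beta] of the lowest block, without its power of [x]. Up to
   powers of two it bounds the blocks used: [Vge] from below for group [0], [Vle] from above for the
   groups below [D * E2]. *)
pose P : R := \prod_(i < K) ((2 ^ i * D)%:R * (1 - beta)).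
have lamP : lam ^+ K <= P.
  rewrite -[X in lam ^+ X]card_ord -prodr_const; apply: ler_prod => i _.
  rewrite ltW //= -[lam]mul1r ler_pM ?(ltW lam0) // ?ler1n ?muln_gt0 ?expn_gt0 //; lra.
have P0 : 0 < P by apply: lt_le_trans lamP; rewrite exprn_gt0.
pose c0 := (2 * n * (K.+1 * n * Lam * (2 ^ E2.+1) ^ K))%N.
have n0 : (0 < n)%N by apply: leq_trans Wn; apply: leq_trans WMrW.
have c01 : (0 < c0)%N by rewrite !muln_gt0 n0 Lam0 !expn_gt0.
(* [T] makes [l * (3 * (c0%:R * P)) <= P / 2 ^+ (K + 3)], where [c0%:R * P] is [2 n] times [dmax];
   the factor [Lam] of [c0] cancels against [lam]. *)
pose T := (48 * K.+1 * n ^ 2 * 2 ^ (K * (E2 + 2)))%N.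
have T0 : (0 < T)%N by rewrite !muln_gt0 !expn_gt0 n0.
pose dmax : R := (K.+1 * n * Lam)%:R * (P * (2 ^ E2.+1)%:R ^+ K).
pose l := lam / T%:R.
have bE : beta = alpha + T%:R * l by rewrite /l mulrC divfK ?pnatr_eq0 -?lt0n.
have bM : (D * E2 <= M)%N by rewrite leq_mul.
have Mn : (M <= n)%N by apply: leq_trans Wn; rewrite -mulnA leq_pmulr // muln_gt0 r00 W0.
have dmax0 : 0 <= dmax by rewrite mulr_ge0 // mulr_ge0 ?exprn_ge0 // ltW.
(* As [lam <= 1 - beta], the distance to 1 varies by at most a factor of 2 on the piece. *)
have key x : alpha <= x <= beta ->
    [/\ 0 <= x <= 1, lam <= 1 - x, 1 - x <= h & 1 - x <= 2 * (1 - beta)].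
  by move=> /andP[ax xb]; split; lra.
have small x m : alpha <= x <= beta -> (m <= M * r0 * W)%N ->
    m%:R * (8 * D%:R) * (1 - x) <= 1.
  move=> /key[/andP[_ x1] _ xh _] mM; apply: le_trans tDE; rewrite -!mulrA ler_pM ?ler_nat //.
    by rewrite !mulr_ge0 //; lra.
  by rewrite ler_wpM2l // ler_wpM2l //; lra.
have Vle x j : alpha <= x <= beta -> (j < D * E2)%N ->
    (thue_morse_poly R K (lag j)).[x] <= P * (2 ^ E2.+1)%:R ^+ K.
  move=> /key[xI _ _ x2] jb; apply: le_trans (thue_morse_poly_le _ _ xI) _.
  rewrite /P -[X in _ ^+ X]card_ord -prodr_const -big_split /=; apply: ler_prod => i _.
  have x0 : 0 <= 1 - x by rewrite subr_ge0; case/andP: xI.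
  rewrite mulr_ge0 //=; apply: (@le_trans _ _ ((2 ^ i * (2 ^ E2 * D))%:R * (2 * (1 - beta)))).
    by rewrite ler_pM // ler_nat leq_mul // lag_lt.
  by rewrite !natrM !natrX exprS le_eqVlt; apply/orP; left; apply/eqP; ring.
have Vge x : alpha <= x <= beta -> P / 2 ^+ K <= (thue_morse_poly R K (lag 0)).[x].
  move=> xab; have [xI xl xh x2] := key x xab.
  have lag0 : lag 0 = D by rewrite /lag div0n mod0n addn0 mul1n.
  rewrite lag0; apply: le_trans (thue_morse_poly_ge xI _); last first.
    have := small x (2 ^ K * D)%N xab; rewrite -{1}lag0 (leq_trans (lag2 0 M0)) // => /(_ isT).
    have : 0 <= (2 ^ K * D)%:R * (1 - x) by rewrite mulr_ge0 //; lra.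
    by move: ((2 ^ K * D)%:R : R) (D%:R : R) D1 => d e; nra.
  rewrite /P -exprVn -[X in _ ^+ X]card_ord -prodr_const -big_split /=; apply: ler_prod => i _.
  have y0 : 0 <= 1 - beta by lra.
  by rewrite divr_ge0 ?mulr_ge0 //= ler_pM2r ?invr_gt0 // ler_wpM2l //; case/andP: xab => _; lra.
rewrite bE -/T -/M.
(* With [r0 = #|S| ^ (2 ^ K)] candidates the stray proportion is at most [1 / 2], whence
   [th = 3 / 4]. The lower bound is half of the upper one since the power [x ^+ start j r] lies
   between [1 / 2] and [1]; this is why the ratio [8] is needed for lacunarity [4]. *)
apply: (@card_near_double_piece R S neg u val negK neg_u valN val_u n I M r0 (2 ^ K) _ _ _
  v (D * E2) T (3 / 4) alpha l delta (c0%:R * P) (P / 2 ^+ (K + 3)) dmax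
  (fun x j => (thue_morse_poly R K (lag j)).[x] / 2)
  (fun x j => (thue_morse_poly R K (lag j)).[x])) => //.
- move=> j r jM rr; apply/set0Pn; exists (inord (pos j r 0)).
  by apply/imsetP; exists (Ordinal K2).
- by move=> j r jM rr; rewrite /I (leq_trans (leq_imset_card _ _)) // card_ord.
- move=> j r j' r' i jM rr j'M rr' /imsetP[t _ ->] /imsetP[t' _] /(congr1 (@nat_of_ord _)).
  rewrite !inordK ?posn // => E'.
  have [jE rE _] := decode _ _ _ jM rr (ltn_ord t).
  by have [] := decode _ _ _ j'M rr' (ltn_ord t'); rewrite -E' jE rE.
- have : (1 - (#|S| ^ 2 ^ K)%:R^-1) ^+ r0 <= 2^-1 :> R.
    apply: exprn_le_half => //; rewrite lexx andbT subr_ge0 invf_le1 ?ler1n ?ltr0n //.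
  by lra.
- by rewrite divr_ge0 // ltW.
- apply: (@le_trans _ _ (2 * n%:R * dmax)).
    by rewrite ler_wpM2r // ler_wpM2l // ler_nat (leq_trans bM).
  by rewrite /dmax /c0 !natrM !natrX le_eqVlt; apply/orP; left; apply/eqP; ring.
- have dE : delta <= c0%:R * P.
    apply: le_trans dL _; apply: (@le_trans _ _ P); last by rewrite ler_peMl ?(ltW P0) // ler1n.
    have LamV : Lam%:R^-1 = lam by apply: (mulfI (lt0r_neq0 Lam0R)); rewrite Lam1 mulfV ?gt_eqF.
    by apply: le_trans lamP; rewrite -exprVn LamV.
  apply: (@le_trans _ _ (l * (3 * (c0%:R * P)))).
    by rewrite ler_wpM2l ?divr_ge0 ?(ltW lam0) //; lra.
  rewrite ler_pdivlMr ?exprn_gt0 // /l [_ * 2 ^+ _]mulrC.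
  have -> : 2 ^+ (K + 3) * (lam / T%:R * (3 * (c0%:R * P))) =
      (2 ^+ (K + 3) * lam * 3 * c0%:R) * P / T%:R by ring.
  rewrite ler_pdivrMr ?ltr0n // mulrC ler_pM2l //.
  have -> : 2 ^+ (K + 3) * lam * 3 * c0%:R =
      Lam%:R * lam * (6 * 2 ^+ (K + 3) * (n%:R ^+ 2 * K.+1%:R * (2 ^ E2.+1) %:R ^+ K)).
    by rewrite /c0 !natrM !natrX; ring.
  rewrite Lam1 mul1r /T !natrM !natrX -exprM (_ : K * (E2 + 2) = E2.+1 * K + K)%N; last by clear; lia.
  by rewrite !exprD le_eqVlt; apply/orP; left; apply/eqP; ring.
move=> x; rewrite -bE => xab; have [xI xl xh x2] := key x xab; have /andP[x0 x1] := xI.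
have Vge0 j : 0 <= (thue_morse_poly R K (lag j)).[x] by exact: thue_morse_poly_ge0.
have startM j r : (j < M)%N -> (r < r0)%N -> (start j r <= M * r0 * W)%N.
  by move=> jM rr; rewrite leq_mul // ltnW // jr.
split.
- move=> j r jM rr; rewrite spE // hornerM hornerXn normrM (ger0_norm (Vge0 j)).
  rewrite ger0_norm ?exprn_ge0 //; apply/andP; split; last first.
    by rewrite ler_piMl // exprn_ile1.
  rewrite mulrC ler_wpM2r //.
  have := one_subX_le (start j r) xI; have := small x _ xab (startM j r jM rr).
  have : 0 <= (start j r)%:R * (1 - x) by rewrite mulr_ge0 //; lra.
  by move: ((start j r)%:R : R) (D%:R : R) D1 => d e; nra.
- move=> j r jb rr; have jM := leq_trans jb bM.
  rewrite spE // derivM derivXn hornerD !hornerM hornerMn !hornerXn.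
  have V0 := Vge0 j.
  have dV := @thue_morse_deriv_le R K (lag j) n x xI (leq_trans (lag2 j jM) (leq_trans WMrW Wn)).
  (* The factor [1 / (1 - x)] of the logarithmic derivative is at most [Lam]. *)
  have Lx : 1 <= Lam%:R * (1 - x) by have := ler_wpM2l (ltW Lam0R) xl; rewrite Lam1.
  have L1 : 1 <= Lam%:R :> R by rewrite ler1n.
  apply: (@le_trans _ _ ((K.+1 * n * Lam)%:R * (thue_morse_poly R K (lag j)).[x])); last first.
    by rewrite ler_wpM2l // Vle.
  rewrite mulSn mulnDl natrD mulrDl; apply: le_trans (ler_normD _ _) _; apply: lerD.
    rewrite normrM (ger0_norm V0) ler_wpM2r // ger0_norm ?mulrn_wge0 ?exprn_ge0 //.
    rewrite -mulr_natl natrM ler_pM ?exprn_ge0 // ?ler_nat.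
      by rewrite (leq_trans (startM j r jM rr)).
    by apply: le_trans L1; rewrite exprn_ile1.
  rewrite normrM ger0_norm ?exprn_ge0 //.
  apply: (@le_trans _ _ (`|(thue_morse_poly R K (lag j))^`().[x]| * (Lam%:R * (1 - x)))).
    by rewrite mulrC ler_wpM2l // (le_trans _ Lx) // exprn_ile1.
  by rewrite mulrCA [(K * n * Lam)%N]mulnC natrM -mulrA ler_wpM2l.
- by move=> j jM; rewrite divr_ge0 //=; have := Vge0 j; lra.
- move=> j jM.
  have : 8 * (thue_morse_poly R (12 * D) (lag j)).[x] <= (thue_morse_poly R (12 * D) (lag j.+1)).[x].
    apply: thue_morse_poly_ratio => //.
    have := small x _ xab (leq_trans (lag2 _ jM) WMrW).
    rewrite -/K; move: (lag j.+1) (2 ^ K)%N => p q.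
    by rewrite -!natrM (_ : q * p * (8 * D) = 8 * D * q * p)%N //; clear; lia.
  by rewrite -/K; lra.
- have := Vge x xab; rewrite exprD.
  have : 0 < P / 2 ^+ K by rewrite divr_gt0 // exprn_gt0.
  rewrite invfM mulrA; lra.
Qed.
End ZoneTwo.

(** * Counting integer polynomials *)

(** Here [t] is a discrete logarithm of [n], so powers of [n] become exponentials in [t] with
    natural exponents; the constants are absorbed by [2 ^ t]. *)
Lemma poly_lt_exp g t n a X : (n < 2 ^ (g * t.+1))%N -> (X * 2 ^ (g * a) <= t)%N ->
  (X * n ^ a <= 2 ^ ((g * a).+1 * t))%N.
Proof.
move=> nt Xt; apply: (@leq_trans (X * 2 ^ (g * t.+1 * a))).
  rewrite leq_mul // expnM; case: a {Xt} => // a; rewrite leq_exp2r //; exact: ltnW.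
rewrite (_ : g * t.+1 * a = g * a + g * a * t)%N; last by clear; lia.
rewrite expnD mulnA mulSn expnD leq_mul // (leq_trans Xt) //.
by rewrite ltnW // ltn_expl.
Qed.

Section Counting.
Variables (R : rcfType) (S : finType) (neg : S -> S) (u : S) (val : S -> R) (N : nat).
Hypotheses (negK : involutive neg) (neg_u : neg u != u).
Hypotheses (valN : forall a, val (neg a) = - val a) (val_u : val u = 1).
Hypothesis val_bnd : forall a, 1 <= `|val a| <= N%:R.

(** For smaller [x] the constant coefficient, of absolute value at least 1, exceeds the rest, which
    is at most [N x / (1 - x)]. *)
Lemma coef_poly_root_ge n (w : {ffun 'I_n.+1 -> S}) x : 0 <= x ->
  (coef_poly val (fun=> false) w).[x] = 0 -> (2 * N)%:R^-1 <= x.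
Proof.
move=> x0 Fx; have N1 : 1 <= N%:R :> R by have /andP[] := val_bnd u; exact: le_trans.
rewrite leNgt natrM; apply/negP => xN.
have N0 : 0 < N%:R :> R by apply: lt_le_trans N1.
have {}xN : 2 * N%:R * x < 1 by rewrite -ltr_pdivlMl ?mulr_gt0 // mulr1.
move: Fx; rewrite /coef_poly big_ord_recl /= hornerD hornerZ hornerXn !expr0 mulr1 mul1r.
move=> /eqP; rewrite addr_eq0 => /eqP E.
have /andP[w1 _] := val_bnd (w ord0).
have : 1 <= N%:R * \sum_(i < n) x ^+ i.+1.
  apply: le_trans w1 _; rewrite E normrN horner_sum mulr_sumr.
  apply: le_trans (ler_norm_sum _ _ _) _; apply: ler_sum => i _.
  rewrite mul1r hornerZ hornerXn normrM [ `|x ^+ _|]ger0_norm ?exprn_ge0 //.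
  by rewrite ler_wpM2r ?exprn_ge0 //; case/andP: (val_bnd (w (lift ord0 i))).
have : (1 - x) * \sum_(i < n) x ^+ i.+1 <= x.
  under eq_bigr do rewrite exprS; rewrite -mulr_sumr mulrCA.
  have <- : 1 - x ^+ n = (1 - x) * \sum_(i < n) x ^+ i.
    by rewrite -[in LHS](expr1n _ n) subrXX; congr (_ * _); apply: eq_bigr => i _; rewrite expr1n mul1r.
  by rewrite ler_piMr // gerBl exprn_ge0.
have : 0 <= \sum_(i < n) x ^+ i.+1 by rewrite sumr_ge0 // => i _; rewrite exprn_ge0.
move: (\sum_(i < n) _) => s s0 s1 s2.
have x2 : 2 * x < 1 by nra.
have : s <= 2 * x by nra.
nra.
Qed.

Lemma pow_half_le m e t : (0 < m)%N -> (1 - m%:R^-1) ^+ (m * (e * t)) <= 2 ^- (e * t) :> R.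
Proof.
move=> m0; have m1 : m%:R^-1 <= 1 :> R by rewrite invf_le1 ?ler1n ?ltr0n.
rewrite exprM -exprVn; apply: lerXn2r; rewrite ?nnegrE ?invr_ge0 ?exprn_ge0 ?subr_ge0 //.
by apply: exprn_le_half; rewrite // lexx subr_ge0 m1.
Qed.

(* [2 ^- (r * t)] absorbs [2 ^+ (z * t)] and powers of [n], as [n < 2 ^ (g * (t + 1))]. *)
Lemma absorb g t n (r z X : nat) (a A : nat) : (n < 2 ^ (g * t.+1))%N -> (0 < n)%N ->
  (2 * X * 2 ^ (g * (a + A)) <= t)%N ->
  ((g * (a + A)).+1 + z <= r)%N ->
  (X * n ^ a)%:R * 2 ^+ (z * t) * 2 ^- (r * t) <= n%:R ^- A / 2 :> R.
Proof.
move=> nt n0 Xt zr.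
have := poly_lt_exp nt Xt; rewrite -(ler_nat R).
rewrite natrM natrX (natrX _ 2) natrM exprD mulrA => h.
have n0R : 0 < n%:R :> R by rewrite ltr0n.
rewrite ler_pdivrMr ?exprn_gt0 // mulrAC ler_pdivlMr // ler_pdivlMl ?exprn_gt0 //.
rewrite natrM natrX.
apply: (@le_trans _ _ (2 ^+ ((g * (a + A)).+1 * t) * 2 ^+ (z * t))); last first.
  by rewrite -exprD -mulnDl ler_weXn2l ?ler1n // leq_mul.
rewrite [X in X <= _](_ : _ = (2 * X%:R) * n%:R ^+ a * n%:R ^+ A * 2 ^+ (z * t)); last by ring.
by rewrite ler_wpM2r // exprn_ge0.
Qed.

(** Cut the range into [n ^ 6 - 1] pieces of length [n^(-6)]. A piece below [1 / (2 N)] contains no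
    roots; the others end before [1 - 1 / H] and are inner, or are outer. The union bound costs
    [n ^ 6]. *)
Lemma card_near_double_pieces (n H M b D E E2 B A : nat)
    (s := (2 * #|S|)%N) (c := (4 * N)%N) (K := (12 * D)%N)
    (r0 := (#|S| ^ (2 ^ K))%N) (W := (D * 2 ^ E * 2 ^ K)%N) :
  (1 < n)%N -> (0 < H)%N -> (H <= n)%N -> (0 < M)%N -> (b <= M)%N -> (2 * H * M <= n)%N ->
  (2 * c <= n)%N -> (0 < D)%N -> (0 < E2)%N -> (E2 <= E)%N ->
  (16 * D * (D * E * r0 * W) <= H)%N ->
  ((4 * c) ^ M <= n ^ B)%N -> (6 * K <= B)%N ->
  (48 * n ^ 2 * (4 * c) ^ b)%:R * (1 - s%:R^-1) ^+ M + (n.*2 + 3)%:R * (1 - s%:R^-1) ^+ b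
    <= n%:R ^- A :> R ->
  (48 * K.+1 * n ^ 2 * 2 ^ (K * (E2 + 2)))%:R * (3 / 4) ^+ (D * E)
    + (n.*2 + 3)%:R * (3 / 4) ^+ (D * E2) <= n%:R ^- A :> R ->
  #|[set w : {ffun 'I_n.+1 -> S} |
      `[< near_double (coef_poly val (fun=> false) w) 0 (1 - n%:R ^- 6) (n%:R ^- B) >]]|%:R
    <= n%:R ^+ 6 * n%:R ^- A * #|{: {ffun 'I_n.+1 -> S}}|%:R :> R.
Proof.
move=> n1 H0 Hn M0 bM HMn cn D0 E20 E2E DH cM KB bnd1 bnd2.
have N1 : 1 <= N%:R :> R by have /andP[] := val_bnd u; exact: le_trans.
have N0 : (0 < N)%N by rewrite -(ler1n R).
have c0 : (0 < c)%N by rewrite muln_gt0.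
have n0 : (0 < n)%N by apply: ltnW.
have S0 : (0 < #|S|)%N by apply/card_gt0P; exists u.
have n0R : 0 < n%:R :> R by rewrite ltr0n.
pose lam : R := n%:R ^- 6.
have lam0 : 0 < lam by rewrite invr_gt0 exprn_gt0.
have Lam1 : (n ^ 6)%:R * lam = 1 by rewrite natrX mulfV // expf_neq0 // gt_eqF.
have lamn k : (k <= n)%N -> k%:R * lam <= 1 / n%:R.
  move=> kn; rewrite ler_pdivlMr // mulrAC -natrM -[X in _ <= X]Lam1 ler_wpM2r ?(ltW lam0) // ler_nat.
  by apply: (@leq_trans (n * n)); [rewrite leq_mul|rewrite mulnn leq_pexp2l].
have n2 : 2 <= n%:R :> R by rewrite ler_nat.
have nV : 1 / n%:R <= 2^-1 :> R by rewrite ler_pdivrMr //; lra.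
pose T := (n ^ 6).-1.
have n6 : (1 < n ^ 6)%N by rewrite (leq_trans n1) // -{1}[n]expn1 leq_pexp2l.
have T0 : (0 < T)%N by rewrite /T -ltnS prednK // (leq_trans _ n6).
have Tlam : T%:R * lam = 1 - lam.
  have TE : T.+1 = (n ^ 6)%N by rewrite prednK // (leq_trans _ n6).
  by rewrite -[X in X - lam]Lam1 -TE -natr1; ring.
pose bad := [set w : {ffun 'I_n.+1 -> S} |
  `[< near_double (coef_poly val (fun=> false) w) 0 (1 - lam) (n%:R ^- B) >]].
pose piece (i : 'I_T) := [set w : {ffun 'I_n.+1 -> S} |
  `[< near_double (coef_poly val (fun=> false) w) (i%:R * lam) (i.+1%:R * lam) (n%:R ^- B) >]].
have sub : bad \subset \bigcup_i piece i.
  apply/subsetP => w; rewrite inE => /asboolP[x [xI Fx dFx]].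
  rewrite -[_ - lam]add0r -Tlam in xI.
  have [i iT] := grid_cell T0 xI; rewrite !add0r => xi.
  by apply/bigcupP; exists (Ordinal iT) => //; rewrite inE; apply/asboolP; exists x.
have card_piece i : #|piece i|%:R <= n%:R ^- A * #|{: {ffun 'I_n.+1 -> S}}|%:R :> R.
  have alpha0 : 0 <= i%:R * lam by rewrite mulr_ge0 // ltW.
  have betaE : i.+1%:R * lam = i%:R * lam + lam by rewrite -natr1 mulrDl mul1r.
  have beta1 : i.+1%:R * lam <= 1 - lam by rewrite -Tlam ler_wpM2r ?(ltW lam0) // ler_nat.
  have d0 : 0 <= n%:R ^- B :> R by rewrite invr_ge0 exprn_ge0.
  have [betaN|betaN] := ltP (i.+1%:R * lam) (2 * N)%:R^-1.
    rewrite [piece i](_ : _ = finset.set0); first by rewrite cards0 mulr_ge0 ?invr_ge0 ?exprn_ge0.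
    apply/setP => w; rewrite !inE; apply/negP => /asboolP[x [/andP[x1 x2] Fx _]].
    have := coef_poly_root_ge (le_trans alpha0 x1) Fx.
    by move=> /le_trans/(_ x2); rewrite leNgt betaN.
  have calpha : c%:R^-1 <= i%:R * lam.
    have : c%:R * lam <= 2^-1 by apply: le_trans nV; apply: lamn; apply: leq_trans cn; rewrite leq_pmull.
    have -> : c%:R^-1 = (2 * N)%:R^-1 - c%:R^-1 :> R.
      by rewrite /c !natrM; field; rewrite gt_eqF // (lt_le_trans _ N1).
    have lamc : lam <= c%:R^-1.
      rewrite -[c%:R^-1]mul1r ler_pdivlMr ?ltr0n // mulrC.
      by apply: le_trans (lamn c _) _; [apply: leq_trans cn; rewrite leq_pmull|lra].
    by move: betaN; rewrite betaE; lra.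
  have [beta_in|beta_out] := lerP (i.+1%:R * lam) (1 - H%:R^-1).
    apply: le_trans (@card_near_double_inner R S neg u val negK neg_u valN val_u n c
      H M b (i%:R * lam) lam (i.+1%:R * lam) (n%:R ^- B) c0 M0 bM H0 HMn _ betaE calpha beta_in _ _) _.
    - by rewrite lam0 /=; lra.
    - have := lamn n (leqnn n); have : (c * n)%:R * lam <= 2^-1; last by rewrite natrM.
      apply: (@le_trans _ _ ((n * n)%:R * lam / 2)).
        rewrite [X in _ <= X]mulrAC ler_wpM2r ?(ltW lam0) // ler_pdivlMr // -natrM ler_nat.
        by rewrite mulnAC [(c * 2)%N]mulnC leq_mul.
      rewrite -[X in _ <= X]mul1r ler_wpM2r ?invr_ge0 // -[X in _ <= X]Lam1 ler_wpM2r ?(ltW lam0) // ler_nat.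
      by rewrite mulnn leq_pexp2l.
    - rewrite d0 /= lef_pV2 ?posrE ?exprn_gt0 ?ltr0n ?muln_gt0 ?N0 //.
      by rewrite -(natrX R (4 * c)) -(natrX R n) ler_nat.
    - by rewrite ler_wpM2r.
  (* [h = 2 / H] since [1 - alpha = (1 - beta) + lam] and both terms are at most [1 / H]. *)
  apply: le_trans (@card_near_double_outer R S neg u val negK neg_u valN val_u n D E E2 (n ^ 6)
    (i%:R * lam) lam (i.+1%:R * lam) (2 / H%:R) (n%:R ^- B) D0 E20 E2E _ Lam1 betaE alpha0 _ _ _ _) _.
  - by apply: leq_trans (leq_trans DH Hn); rewrite -/K -/r0 -/W leq_pmull // muln_gt0 /= D0.
  - by move: beta1; set z := _ * lam; lra.
  - have : lam <= H%:R^-1.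
      rewrite -[H%:R^-1]mul1r ler_pdivlMr ?ltr0n // mulrC.
      by apply: le_trans (lamn H Hn) _; lra.
    by move: beta_out; rewrite betaE; lra.
  - rewrite mulrA ler_pdivrMr ?ltr0n // mul1r -/K -/r0 -/W -!natrM ler_nat.
    by apply: leq_trans DH; rewrite leq_eqVlt; apply/orP; left; apply/eqP; clear; lia.
  - rewrite d0 lef_pV2 ?posrE ?exprn_gt0 ?ltr0n ?expn_gt0 ?n0 //.
    by rewrite -(natrX R (n ^ 6)) -(natrX R n) ler_nat -expnM leq_pexp2l.
  - by rewrite ler_wpM2r.
rewrite -/lam -/bad -mulrA; apply: (@le_trans _ _ (\sum_i #|piece i|%:R)).
  rewrite -natr_sum ler_nat; apply: leq_trans (subset_leq_card sub) _.
  elim/big_rec2: _ => [|i k U _ le]; first by rewrite cards0.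
  by rewrite (leq_trans (leq_card_setU _ _)) // leq_add2l.
apply: le_trans (ler_sum _ (fun i _ => card_piece i)) _.
rewrite sumr_const card_ord -[_ *+ T]mulr_natl ler_wpM2r //.
  by rewrite mulr_ge0 // invr_ge0 exprn_ge0.
by rewrite -natrX ler_nat leq_pred.
Qed.
Lemma card_near_double (Cn : nat) : exists B n0 : nat, forall n, (n0 <= n)%N ->
  #|[set w : {ffun 'I_n.+1 -> S} |
      `[< near_double (coef_poly val (fun=> false) w) 0 (1 - n%:R ^- 6) (n%:R ^- B) >]]|%:R
    <= n%:R ^- Cn * #|{: {ffun 'I_n.+1 -> S}}|%:R :> R.
Proof.
have N0 : (0 < N)%N.
  by rewrite -(ler1n R); have /andP[] := val_bnd u; exact: le_trans.
have S0 : (0 < #|S|)%N by apply/card_gt0P; exists u.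
have q3 : (3 / 4) ^+ 3 <= 2^-1 :> R by lra.
(* With [E = q t] and [E2 = t] the outer gain [(3 / 4) ^+ (D * E)] is at most [2 ^- (16 D t)], which
   beats the grid factor of order [2 ^ (12 D t)]. *)
have [q q0 q16] : exists2 q, (0 < q)%N & (3 / 4) ^+ q <= 2 ^- 16 :> R.
  exists (3 * 16)%N => //; rewrite exprM -exprVn; apply: lerXn2r => //; rewrite nnegrE; lra.
(* The [6] pays for the number of pieces. *)
have [A AE] : exists A, A = (Cn + 6)%N by exists (Cn + 6)%N.
(* [n] will lie between [2 ^ (g t)] and [2 ^ (g (t + 1))]; [g = 8 q] leaves room for
   [H = 2 ^ (3 q t)] and the products required to be at most [n]. *)
have [g gE] : exists g, g = (8 * q)%N by exists (8 * q)%N.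
have [c cE] : exists c, c = (4 * N)%N by exists (4 * N)%N.
have [s sE] : exists s, s = (2 * #|S|)%N by exists (2 * #|S|)%N.
(* [2 ^- (e2 t)] beats [n ^ (1 + A)], for the critical points. [e1] beats [n ^ (2 + A)] and the
   factor [(4 c) ^ b] of the grid, where [b = s e2 t] and [M = s (e1 + e2) t]. [D = 3 e2] uses
   [(3 / 4)^3 <= 1 / 2]. *)
have [e2 e2E] : exists e2, e2 = (g * (1 + A)).+1 by exists (g * (1 + A)).+1.
have [e1 e1E] : exists e1, e1 = ((g * (2 + A)).+1 + 4 * c * s * e2)%N.
  by exists ((g * (2 + A)).+1 + 4 * c * s * e2)%N.
have [D DE] : exists D, D = (3 * e2)%N by exists (3 * e2)%N.
have [K KE] : exists K, K = (12 * D)%N by exists (12 * D)%N.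
pose r0 := (#|S| ^ (2 ^ K))%N.
pose m := (s * (e1 + e2))%N.
pose c1 := (16 * D * D * D * r0 * 2 ^ K)%N.
have [X XE] : exists X, X = (48 * K.+1 * 2 ^ (K * 2))%N by exists (48 * K.+1 * 2 ^ (K * 2))%N.
(* Each summand is one of the lower bounds on [t] needed below. *)
pose t0 := (c1 + 2 * m + 2 * X * 2 ^ (g * (2 + A)) + 2 * 48 * 2 ^ (g * (2 + A))
   + 2 * 5 * 2 ^ (g * (1 + A)) + 2 * c + 1)%N.
exists (4 * c * m + 6 * K)%N, (2 ^ (g * t0))%N => n n0n.
have g0 : (0 < g)%N by rewrite gE muln_gt0.
have n0 : (0 < n)%N by apply: leq_trans n0n; rewrite expn_gt0.
pose t := (trunc_log 2 n %/ g)%N.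
have nt : (n < 2 ^ (g * t.+1))%N.
  apply: leq_trans (trunc_log_ltn n (isT : 1 < 2)%N) _.
  by rewrite leq_exp2l // mulnC -ltn_divLR.
have tn : (2 ^ (g * t) <= n)%N.
  apply: leq_trans (trunc_logP (isT : 1 < 2)%N n0).
  by rewrite leq_exp2l // mulnC leq_divM.
have t0t : (t0 <= t)%N.
  by rewrite leq_divRL // mulnC trunc_log_max.
move: t nt tn t0t {n0n} => t nt tn t0t.
have t1 : (0 < t)%N by apply: leq_trans t0t; rewrite /t0 addn1.
have [[tc1 tm tX] [t48 t5 tc]] : [/\ c1 <= t, 2 * m <= t & 2 * X * 2 ^ (g * (2 + A)) <= t]%N /\
    [/\ 2 * 48 * 2 ^ (g * (2 + A)) <= t, 2 * 5 * 2 ^ (g * (1 + A)) <= t & 2 * c <= t]%N.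
  move: t0t; rewrite /t0; move: (c1) (2 * m)%N (2 * X * _)%N (2 * 48 * _)%N (2 * 5 * _)%N (2 * c)%N.
  by clear; move=> *; split; split; lia.
have t2t : (t <= 2 ^ (q * t))%N.
  by apply: leq_trans (ltnW (ltn_expl t (isT : 1 < 2)%N)) _; rewrite leq_exp2l // leq_pmull.
have e20 : (0 < e2)%N by rewrite e2E.
have s0 : (0 < s)%N by rewrite sE muln_gt0.
have D0 : (0 < D)%N by rewrite DE muln_gt0.
have n1 : (1 < n)%N.
  by apply: leq_trans tn; rewrite -{1}(expn1 2) leq_exp2l // muln_gt0 g0.
have pow4c e : ((4 * c) ^ e <= 2 ^ (4 * c * e))%N.
  rewrite expnM; case: e => // e; rewrite leq_exp2r //; exact/ltnW/ltn_expl.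
have n5 : (n.*2 + 3)%:R <= (5 * n ^ 1)%:R :> R.
  by rewrite ler_nat expn1; move: n0; clear; lia.
have small2 : (5 * n ^ 1)%:R * 2 ^- (e2 * t) <= n%:R ^- A / 2 :> R.
  have := @absorb g t n e2 0 5 1 A nt n0 t5.
  by rewrite mul0n expr0 mulr1; apply; rewrite e2E addn0.
have := @card_near_double_pieces n (2 ^ (3 * (q * t))) (s * ((e1 + e2) * t)) (s * (e2 * t)) D
  (q * t) t (4 * c * m + 6 * K) A.
rewrite -cE -KE -/r0 -sE => H; apply: le_trans (H _ _ _ _ _ _ _ _ _ _ _ _ _ _ _) _ => //.
- by rewrite expn_gt0.
- apply: leq_trans tn; rewrite leq_exp2l // gE mulnA leq_mul // leq_mul //.
- by rewrite !muln_gt0 s0 t1 addn_gt0 e20 orbT.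
- by rewrite leq_mul // leq_mul // leq_addl.
- rewrite (_ : 2 * _ * _ = 2 * m * t * 2 ^ (3 * (q * t)))%N; last by rewrite /m; clear; lia.
  apply: leq_trans tn.
  apply: (@leq_trans (2 ^ (q * t) * 2 ^ (q * t) * 2 ^ (3 * (q * t)))).
    by rewrite leq_mul // leq_mul // (leq_trans tm).
  by rewrite -!expnD leq_exp2l // gE -mulnA; move: (q * t)%N; clear; lia.
- apply: leq_trans tc _; apply: leq_trans tn; apply: leq_trans t2t _.
  by rewrite leq_exp2l // gE leq_mul // leq_pmull.
- by rewrite leq_pmull.
- apply: (@leq_trans (c1 * (q * t) * 2 ^ (q * t))).
    by rewrite /c1 leq_eqVlt; apply/orP; left; apply/eqP; clear; lia.
  rewrite (_ : 3 * (q * t) = q * t + q * t + q * t)%N; last by clear; lia.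
  rewrite !expnD leq_mul // leq_mul //; first exact: leq_trans tc1 t2t.
  exact/ltnW/ltn_expl.
- apply: leq_trans (pow4c _) _.
  rewrite (_ : 4 * c * _ = t * (4 * c * m))%N; last by rewrite /m; clear; lia.
  apply: (@leq_trans (2 ^ (g * t * (4 * c * m)))).
    by rewrite leq_exp2l // leq_mul // leq_pmull.
  rewrite expnM; apply: (@leq_trans (n ^ (4 * c * m))).
    by case: (4 * c * m)%N => // e; rewrite leq_exp2r.
  by rewrite leq_pexp2l // leq_addr.
- by rewrite leq_addl.
- rewrite [X in _ <= X]splitr; apply: lerD; last first.
    by apply: le_trans small2; rewrite ler_pM ?pow_half_le // exprn_ge0 // subr_ge0 invf_le1 ?ler1n ?ltr0n.
  have e1e2 : ((g * (2 + A)).+1 + 4 * c * s * e2 <= e1 + e2)%N by rewrite -e1E leq_addr.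
  apply: le_trans (absorb nt n0 t48 e1e2); apply: ler_pM => //; last exact: pow_half_le.
    by rewrite exprn_ge0 // subr_ge0 invf_le1 ?ler1n ?ltr0n.
  rewrite -(natrX R 2) -natrM ler_nat leq_mul //; apply: leq_trans (pow4c _) _.
  by rewrite leq_eqVlt; apply/orP; left; apply/eqP; congr expn; clear; lia.
- have q34 : 0 <= 3 / 4 :> R by lra.
  rewrite [X in _ <= X]splitr; apply: lerD; last first.
    apply: le_trans small2; rewrite ler_pM // ?exprn_ge0 ?divr_ge0 //.
    by rewrite DE -mulnA exprM -exprVn; apply: lerXn2r; rewrite // nnegrE ?exprn_ge0 ?invr_ge0.
  have e16 : ((g * (2 + A)).+1 + K <= 16 * D)%N by rewrite KE DE e2E; clear; lia.
  apply: le_trans (absorb nt n0 tX e16); apply: ler_pM => //; first by rewrite exprn_ge0.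
    rewrite -(natrX R 2) -natrM ler_nat XE mulnDr expnD.
    by rewrite leq_eqVlt; apply/orP; left; apply/eqP; clear; lia.
  rewrite mulnCA (exprM _ q) -mulnA (exprM 2 16) -exprVn; apply: lerXn2r.
  - by rewrite nnegrE !exprn_ge0.
  - by rewrite nnegrE ?invr_ge0 ?exprn_ge0 ?invr_ge0.
  - by rewrite ?exprVn.
apply: ler_wpM2r => //; rewrite AE exprD invfM mulrCA mulfV ?mulr1 //.
by rewrite expf_neq0 // pnatr_eq0 -lt0n.
Qed.
End Counting.

(** * Reversal, reflection and integrality at 1 *)

Section OrdPoly.
Variables (R : rcfType) (n : nat).
Implicit Types (c : 'I_n.+1 -> R) (x y delta : R).

Definition ord_poly c : {poly R} := \sum_(i < n.+1) c i *: 'X^i.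

Lemma horner_ord_poly c x : (ord_poly c).[x] = \sum_(i < n.+1) c i * x ^+ i.
Proof. by rewrite horner_sum; apply: eq_bigr => i _; rewrite hornerZ hornerXn. Qed.

Lemma horner_deriv_ord_poly c x :
  (ord_poly c)^`().[x] = \sum_(i < n.+1) c i * (x ^+ i.-1 *+ i).
Proof.
rewrite (raddf_sum (deriv (R := R))) horner_sum; apply: eq_bigr => i _ /=.
by rewrite derivZ derivXn hornerZ hornerMn hornerXn.
Qed.

Lemma mul_horner_deriv_ord_poly c x :
  x * (ord_poly c)^`().[x] = \sum_(i < n.+1) i%:R * (c i * x ^+ i).
Proof.
rewrite horner_deriv_ord_poly mulr_sumr; apply: eq_bigr => i _.
case: (nat_of_ord i) => [|k]; first by rewrite mulr0n mulr0 mulr0 mul0r.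
by rewrite exprS -mulr_natl; ring.
Qed.

Lemma ord_poly_rev c x : x != 0 ->
  (ord_poly c).[x] = x ^+ n * (ord_poly (c \o @rev_ord _)).[x^-1].
Proof.
move=> x0; rewrite !horner_ord_poly mulr_sumr (reindex_inj rev_ord_inj) /=.
apply: eq_bigr => i _; rewrite subSS mulrCA; congr (_ * _).
rewrite exprVn; have ile : (i <= n)%N by rewrite -ltnS.
have -> : x ^+ n = x ^+ (n - i) * x ^+ i by rewrite -exprD subnK.
by rewrite mulfK // expf_neq0.
Qed.

Lemma deriv_ord_poly_rev c x : x != 0 ->
  x * (ord_poly c)^`().[x] = n%:R * (ord_poly c).[x]
    - x ^+ n * (x^-1 * (ord_poly (c \o @rev_ord _))^`().[x^-1]).
Proof.
move=> x0; rewrite !mul_horner_deriv_ord_poly horner_ord_poly !mulr_sumr.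
rewrite [X in _ - X](reindex_inj rev_ord_inj) /= -sumrB; apply: eq_bigr => i _.
rewrite /= !subSS rev_ordK; have ile : (i <= n)%N by rewrite -ltnS.
have -> : x ^+ n * ((n - i)%:R * (c i * x^-1 ^+ (n - i))) = (n - i)%:R * (c i * x ^+ i).
  have -> : x ^+ n = x ^+ (n - i) * x ^+ i by rewrite -exprD subnK.
  rewrite exprVn mulrCA; congr (_ * _); rewrite mulrCA; congr (_ * _).
  by rewrite mulrAC mulfV ?mul1r // expf_neq0.
by rewrite natrB //; ring.
Qed.

(** For the reversed polynomial [Q], [P(x) = x^n Q(1/x)]; at a root only the term with [Q']
    survives, so [|P'(x)| = |x|^(n-2) |Q'(1/x)| >= |Q'(1/x)|]. *)
Lemma near_double_rev c x delta : (1 < n)%N -> 1 <= `|x| -> (ord_poly c).[x] = 0 ->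
  `|(ord_poly c)^`().[x]| <= delta ->
  [/\ `|x^-1| <= 1, (ord_poly (c \o @rev_ord _)).[x^-1] = 0
    & `|(ord_poly (c \o @rev_ord _))^`().[x^-1]| <= delta].
Proof.
move=> n1 x1 Fx dFx; have x0 : 0 < `|x| by apply: lt_le_trans x1.
have xn0 : x != 0 by rewrite -normr_gt0.
split; first by rewrite normfV invf_le1.
  have := ord_poly_rev c xn0; rewrite Fx => /esym/eqP.
  by rewrite mulf_eq0 expf_eq0 (negPf xn0) andbF /= => /eqP.
apply: le_trans dFx; have := deriv_ord_poly_rev c xn0.
rewrite Fx mulr0 sub0r => E; set g := (ord_poly (c \o _))^`().[_] in E *.
have : `|x| * `|(ord_poly c)^`().[x]| = `|x| ^+ n * `|x|^-1 * `|g|.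
  by rewrite -normrM E normrN mulrA !normrM normrX normfV.
case: n n1 => [|[|m]] // _; rewrite exprSr mulfK ?gt_eqF // exprSr -mulrA mulrCA.
move=> /(mulfI (lt0r_neq0 x0)) ->.
by rewrite ler_peMl // exprn_ege1.
Qed.

Lemma ord_poly_opp c x :
  (ord_poly c).[- x] = (ord_poly (fun i => (-1) ^+ i * c i)).[x] /\
  (ord_poly c)^`().[- x] = - (ord_poly (fun i => (-1) ^+ i * c i))^`().[x].
Proof.
have E : ord_poly (fun i => (-1) ^+ i * c i) = ord_poly c \Po (- 'X).
  rewrite /ord_poly (raddf_sum (comp_poly (- 'X))); apply: eq_bigr => i _ /=.
  rewrite comp_polyZ comp_Xn_poly (exprNn 'X) [_ * c i]mulrC -scalerA; congr (_ *: _).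
  by rewrite -mul_polyC polyC_exp polyCN polyC1.
rewrite E; split; first by rewrite horner_comp !hornerE.
by rewrite deriv_comp derivN derivX mulrN1 hornerN horner_comp !hornerE opprK.
Qed.

Lemma ord_poly_le c (N : R) x : `|x| <= 1 -> (forall i, `|c i| <= N) ->
  `|(ord_poly c).[x]| <= n.+1%:R * N.
Proof.
move=> x1 cN; rewrite horner_ord_poly; apply: le_trans (ler_norm_sum _ _ _) _.
rewrite -[X in X%:R * _]card_ord mulr_natl -sumr_const; apply: ler_sum => i _.
by rewrite normrM -[leRHS]mulr1 ler_pM // normrX exprn_ile1.
Qed.

Lemma deriv_ord_poly_le c (N : R) x : `|x| <= 1 -> (forall i, `|c i| <= N) ->
  `|(ord_poly c)^`().[x]| <= n.+1%:R * (N * n%:R) /\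
  `|(ord_poly c)^`()^`().[x]| <= n.+1%:R * (N * n%:R ^+ 2).
Proof.
move=> x1 cN; have N0 : 0 <= N by apply: le_trans (cN ord0).
split.
  rewrite horner_deriv_ord_poly; apply: le_trans (ler_norm_sum _ _ _) _.
  rewrite -[X in X%:R * _]card_ord mulr_natl -sumr_const; apply: ler_sum => i _.
  rewrite normrM ler_pM // -mulr_natl normrM normrX -[leRHS]mulr1.
  by rewrite ler_pM ?exprn_ge0 ?exprn_ile1 // ger0_norm // ler_nat -ltnS.
rewrite (raddf_sum (deriv (R := R))) /= (raddf_sum (deriv (R := R))) horner_sum.
apply: le_trans (ler_norm_sum _ _ _) _.
rewrite -[X in X%:R * _]card_ord mulr_natl -sumr_const; apply: ler_sum => i _.
rewrite /= !derivZ derivXn derivMn derivXn hornerZ !hornerMn hornerXn normrM ler_pM //.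
rewrite -mulr_natl -[X in _ * X]mulr_natl mulrA normrM normrX.
rewrite -[leRHS]mulr1 ler_pM ?exprn_ge0 ?exprn_ile1 // ger0_norm ?mulr_ge0 // expr2.
have ile : (i <= n)%N by rewrite -ltnS.
by rewrite ler_pM // ler_nat // (leq_trans (leq_pred _)).
Qed.

Lemma int_norm_lt1 (m : int) : `|m%:~R| < 1 :> R -> m = 0.
Proof. by rewrite -intr_norm -[1]/(1%:~R) ltr_int; lia. Qed.

(* The values at 1 of an integral polynomial and of its derivative are integers. *)
Lemma near_one_double_root (z : 'I_n.+1 -> int) (N : nat) x delta :
  (4 * N + 2 <= n)%N -> (forall i, (`|z i| <= N)%N) ->
  1 - n%:R ^- 6 <= x <= 1 -> delta <= 2^-1 ->
  (ord_poly (fun i => (z i)%:~R)).[x] = 0 ->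
  `|(ord_poly (fun i => (z i)%:~R))^`().[x]| <= delta ->
  (ord_poly (fun i => (z i)%:~R)).[1] = 0 /\ (ord_poly (fun i => (z i)%:~R))^`().[1] = 0.
Proof.
move=> Nn zN /andP[x1 x2] d2 Fx dFx.
have n0 : (0 < n)%N by move: Nn; lia.
have n0R : 0 < n%:R :> R by rewrite ltr0n.
set c := fun i => (z i)%:~R.
have cN i : `|c i| <= N%:R.
  by rewrite /c -intr_norm -[N%:R]/((N : int)%:~R) ler_int; move: (zN i); lia.
have nV : n%:R ^- 6 <= 1 :> R by rewrite invf_le1 ?exprn_gt0 // exprn_ege1 // ler1n.
(* Both [P] and [P'] move by less than [1 / 2] on an interval of length [n^(-6)], since
   [4 N < n]. *)
have small : n%:R ^- 6 * (n.+1%:R * (N%:R * n%:R ^+ 2)) < 2^-1 :> R.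
  rewrite mulrC ltr_pdivrMr ?exprn_gt0 // [ltRHS]mulrC ltr_pdivlMr //.
  rewrite -!natrX -!natrM ltr_nat.
  apply: (@leq_ltn_trans (n * 2 * (N * n ^ 2) * 2)).
    by rewrite leq_mul // leq_mul // muln2 -addnn -addn1 leq_add2l.
  apply: (@leq_trans (n * n * n ^ 2)); last by rewrite mulnn -expnD leq_pexp2l.
  have : (0 < n * n ^ 2)%N by rewrite muln_gt0 n0 expn_gt0 n0.
  move: (n ^ 2)%N Nn; clear; nia.
have bnd y : x <= y <= 1 -> `|(ord_poly c)^`().[y]| <= n.+1%:R * (N%:R * n%:R ^+ 2) /\
    `|(ord_poly c)^`()^`().[y]| <= n.+1%:R * (N%:R * n%:R ^+ 2).
  move=> /andP[xy y1]; have yI : 0 <= y <= 1 by rewrite y1 andbT; lra.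
  have y1' : `|y| <= 1 by rewrite ger0_norm //; case/andP: yI.
  have [h1 h2] := deriv_ord_poly_le y1' cN; split=> //; apply: le_trans h1 _.
  by rewrite ler_wpM2l // ler_wpM2l // ler_eXnr // ler1n.
have X0 : 0 <= n.+1%:R * (N%:R * n%:R ^+ 2) :> R by rewrite !mulr_ge0 // exprn_ge0.
have xn : 1 - x <= n%:R ^- 6 by lra.
have step p : p = ord_poly c \/ p = (ord_poly c)^`() -> `|p.[1] - p.[x]| < 2^-1.
  move=> pE; apply: le_lt_trans small.
  apply: (@le_trans _ _ ((1 - x) * (n.+1%:R * (N%:R * n%:R ^+ 2)))); last by rewrite ler_wpM2r.
  apply: poly_mean_value_le => // y /bnd[b1 b2].
  by case: pE => ->.
split.
  have := step _ (or_introl erefl); rewrite Fx subr0 horner_ord_poly => h.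
  have E : \sum_(i < n.+1) c i * 1 ^+ i = (\sum_i z i)%:~R :> R.
    by rewrite rmorph_sum; apply: eq_bigr => i _; rewrite expr1n mulr1.
  rewrite E in h *; suff -> : \sum_i z i = 0 by [].
  by apply: int_norm_lt1; apply: lt_trans h _; lra.
have := step _ (or_intror erefl) => h.
have {}h : `|(ord_poly c)^`().[1]| < 1.
  have := ler_normD ((ord_poly c)^`().[1] - (ord_poly c)^`().[x]) (ord_poly c)^`().[x].
  by rewrite subrK; move: dFx; rewrite -/c; lra.
have E : (ord_poly c)^`().[1] = (\sum_i z i *+ i)%:~R :> R.
  rewrite horner_deriv_ord_poly rmorph_sum; apply: eq_bigr => i _.
  by rewrite expr1n rmorphMn /= mulr_natr.
by rewrite E in h *; rewrite (int_norm_lt1 h).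
Qed.
End OrdPoly.

Section Symmetries.
Variables (R : rcfType) (S : finType) (neg : S -> S) (u : S) (zval : S -> int) (N : nat).
Hypotheses (negK : involutive neg) (neg_u : neg u != u).
Hypotheses (zvalN : forall a, zval (neg a) = - zval a) (zval_u : zval u = 1).
Hypothesis zval_bnd : forall a, (0 < `|zval a| <= N)%N.

Definition int_poly n (z : {ffun 'I_n.+1 -> S}) : {poly R} :=
  ord_poly (fun i => (zval (z i))%:~R).

(** Reversal brings [x > 1] into [[0, 1]]. Between [1 - n^(-6)] and [1] integrality forces a double
    root at 1, and reversal preserves double roots at 1. *)
Lemma int_poly_double n (z : {ffun 'I_n.+1 -> S}) x delta :
  (4 * N + 2 <= n)%N -> delta <= 2^-1 -> 0 <= x ->
  (int_poly z).[x] = 0 -> `|(int_poly z)^`().[x]| <= delta ->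
  [\/ near_double (int_poly z) 0 (1 - n%:R ^- 6) delta,
      near_double (int_poly [ffun i => z (rev_ord i)]) 0 (1 - n%:R ^- 6) delta
    | (int_poly z).[1] = 0 /\ (int_poly z)^`().[1] = 0].
Proof.
move=> Nn d2.
have zN (z' : {ffun 'I_n.+1 -> S}) i : (`|zval (z' i)| <= N)%N by case/andP: (zval_bnd (z' i)).
have n1 : (1 < n)%N by move: Nn; clear; lia.
have inner (z' : {ffun 'I_n.+1 -> S}) y : 0 <= y <= 1 -> (int_poly z').[y] = 0 ->
    `|(int_poly z')^`().[y]| <= delta ->
    near_double (int_poly z') 0 (1 - n%:R ^- 6) delta \/
    (int_poly z').[1] = 0 /\ (int_poly z')^`().[1] = 0.
  move=> /andP[y0 y1] Fy dFy; have [yn|/ltW yn] := leP y (1 - n%:R ^- 6).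
    by left; exists y; rewrite y0 yn.
  right; apply: (@near_one_double_root R n (fun i => zval (z' i)) N y delta) => //.
  by rewrite yn.
move=> x0 Fx dFx; have [x1|/ltW x1] := leP x 1.
  have [||] := inner z x _ Fx dFx; first by rewrite x0.
    by constructor 1.
  by constructor 3.
have [y1 Fy dFy] : [/\ `|x^-1| <= 1, (ord_poly ((fun i => (zval (z i))%:~R) \o @rev_ord _)).[x^-1] = 0
    & `|(ord_poly ((fun i => (zval (z i))%:~R) \o @rev_ord _))^`().[x^-1]| <= delta].
  by apply: near_double_rev Fx dFx => //; rewrite ger0_norm.
have y01 : 0 <= x^-1 <= 1.
  by rewrite invr_ge0 x0 /=; apply: le_trans y1; rewrite ger0_norm ?invr_ge0.
have revE : ord_poly ((fun i => (zval (z i))%:~R) \o @rev_ord _) =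
    int_poly [ffun i => z (rev_ord i)] :> {poly R}.
  by rewrite /int_poly /ord_poly; apply: eq_bigr => i _; rewrite ffunE.
rewrite revE in Fy dFy; have [h|[g1 dg1]] := inner _ _ y01 Fy dFy; first by constructor 2.
constructor 3; have one0 : (1 : R) != 0 by apply: oner_neq0.
have F1 : (int_poly z).[1] = 0.
  by rewrite /int_poly ord_poly_rev // revE invr1 g1 mulr0.
split=> //; have := deriv_ord_poly_rev (fun i => (zval (z i))%:~R) one0.
by rewrite revE invr1 dg1 !mulr0 subr0 -/(int_poly z) F1 mulr0 mul1r.
Qed.

(** The bad configurations lie in the preimages of one set under four bijections, generated by
    reversal and [x -> - x]. The factor 4 is absorbed by [Cn.+1], and [B.+1] makes the tolerance at
    most [1 / 2]. *)
Lemma card_int_poly_double (Cn : nat) : exists B n0 : nat, forall n, (n0 <= n)%N ->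
  #|[set z : {ffun 'I_n.+1 -> S} |
      `[< (exists x, (int_poly z).[x] = 0 /\ `|(int_poly z)^`().[x]| <= n%:R ^- B) /\
          ~ ((int_poly z).[1] = 0 /\ (int_poly z)^`().[1] = 0 \/
             (int_poly z).[-1] = 0 /\ (int_poly z)^`().[-1] = 0) >]]|%:R
    <= n%:R ^- Cn * #|{: {ffun 'I_n.+1 -> S}}|%:R :> R.
Proof.
pose val a : R := (zval a)%:~R.
have valN a : val (neg a) = - val a by rewrite /val zvalN rmorphN.
have val_u : val u = 1 by rewrite /val zval_u.
have val_bnd a : 1 <= `|val a| <= N%:R.
  have /andP[a0 aN] := zval_bnd a; rewrite /val -intr_norm -[N%:R]/((N : int)%:~R) ler_int.
  by rewrite -[1]/(1%:~R) ler_int; apply/andP; split; lia.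
have [B [n0 H]] := card_near_double negK neg_u valN val_u val_bnd Cn.+1.
exists B.+1, (n0 + 4 * N + 4)%N => n n0n.
have n0' : (n0 <= n)%N by move: n0n; clear; lia.
have {}H := H n n0'.
have Nn : (4 * N + 2 <= n)%N by move: n0n; clear; lia.
have n4 : (4 <= n)%N by move: n0n; clear; lia.
have n0R : 0 < n%:R :> R by rewrite ltr0n; apply: leq_trans n4.
have n4R : 4 <= n%:R :> R by rewrite ler_nat.
pose near (z : {ffun 'I_n.+1 -> S}) := `[< near_double (int_poly z) 0 (1 - n%:R ^- 6) (n%:R ^- B.+1 : R) >].
pose bad0 := [set z : {ffun 'I_n.+1 -> S} | near z].
pose opp (z : {ffun 'I_n.+1 -> S}) : {ffun 'I_n.+1 -> S} :=
  [ffun i : 'I_n.+1 => if odd i then neg (z i) else z i].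
pose rev (z : {ffun 'I_n.+1 -> S}) : {ffun 'I_n.+1 -> S} := [ffun i => z (rev_ord i)].
have oppK : involutive opp.
  by move=> z; apply/ffunP => i; rewrite !ffunE; case: (odd i); rewrite ?negK.
have revK : involutive rev by move=> z; apply/ffunP => i; rewrite !ffunE rev_ordK.
have d2 : n%:R ^- B.+1 <= 2^-1 :> R.
  rewrite lef_pV2 ?posrE ?exprn_gt0 //; apply: le_trans (_ : n%:R <= _); first lra.
  by rewrite exprS ler_peMr ?exprn_ege1 //; lra.
have bad0_le : #|bad0|%:R <= n%:R ^- Cn.+1 * #|{: {ffun 'I_n.+1 -> S}}|%:R :> R.
  apply: le_trans H; rewrite ler_nat subset_leq_card //; apply/subsetP => z.
  rewrite !inE => /asboolP[x [xI Fx dFx]]; apply/asboolP.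
  have cE : coef_poly val (fun=> false) z = int_poly z.
    by apply: eq_bigr => i _; rewrite expr0 mul1r.
  exists x; rewrite cE; split=> //; apply: le_trans dFx _.
  by rewrite lef_pV2 ?posrE ?exprn_gt0 // ler_weXn2l //; lra.
have oppE (z : {ffun 'I_n.+1 -> S}) x : (int_poly z).[- x] = (int_poly (opp z)).[x] /\
    (int_poly z)^`().[- x] = - (int_poly (opp z))^`().[x].
  rewrite /int_poly; have [-> ->] := ord_poly_opp (fun i => (zval (z i))%:~R) x.
  have -> : ord_poly (fun i => (-1) ^+ i * (zval (z i))%:~R) =
    ord_poly (fun i => (zval (opp z i))%:~R) :> {poly R}; last by [].
  rewrite /ord_poly; apply: eq_bigr => i _; rewrite ffunE -signr_odd.
  by case: (odd i); rewrite ?expr1 ?expr0 ?mul1r ?mulN1r ?zvalN ?rmorphN.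
apply: (@le_trans _ _ (#|bad0| + #|bad0| + (#|bad0| + #|bad0|))%:R).
  rewrite ler_nat.
  have pre (f : {ffun 'I_n.+1 -> S} -> {ffun 'I_n.+1 -> S}) (A : {set {ffun 'I_n.+1 -> S}}) :
      involutive f -> #|[set z | f z \in A]| = #|A|.
    move=> fK; rewrite -(card_imset _ (inv_inj fK)); apply: eq_card => z.
    apply/imsetP/idP => [[z' + ->]|zb]; first by rewrite inE.
    by exists (f z); rewrite ?fK // inE fK.
  have pre2 : #|[set z | rev (opp z) \in bad0]| = #|bad0|.
    by rewrite -(pre _ bad0 revK) -(pre _ [set z | rev z \in bad0] oppK); apply: eq_card => z; rewrite !inE.
  apply: (@leq_trans (#|bad0| + #|[set z | rev z \in bad0]|
    + (#|[set z | opp z \in bad0]| + #|[set z | rev (opp z) \in bad0]|))); last first.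
    by rewrite (pre rev _ revK) (pre opp _ oppK) pre2.
  apply: leq_trans (leq_add (leq_card_setU _ _) (leq_card_setU _ _)).
  apply: leq_trans (leq_card_setU _ _); apply: subset_leq_card; apply/subsetP => z.
  rewrite !inE => /asboolP[[x [Fx dFx]] ndr].
  have [x0|/ltW x0] := leP 0 x.
    have [h|h|h] := int_poly_double Nn d2 x0 Fx dFx.
    - by apply/orP; left; apply/orP; left; apply/asboolP.
    - by apply/orP; left; apply/orP; right; apply/asboolP.
    - by case: ndr; left.
  have xN : 0 <= - x by rewrite oppr_ge0.
  have [E1 E2] := oppE z (- x); rewrite opprK in E1 E2.
  have Fx' : (int_poly (opp z)).[- x] = 0 by rewrite -E1.
  have dFx' : `|(int_poly (opp z))^`().[- x]| <= n%:R ^- B.+1 by rewrite -normrN -E2.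
  have [h|h|[h1 h2]] := int_poly_double Nn d2 xN Fx' dFx'.
  - by apply/orP; right; apply/orP; left; apply/asboolP.
  - by apply/orP; right; apply/orP; right; apply/asboolP.
  - by case: ndr; right; have [-> ->] := oppE z 1; rewrite h1 h2 oppr0.
rewrite !natrD; apply: (@le_trans _ _ (4 * (n%:R ^- Cn.+1 * #|{: {ffun 'I_n.+1 -> S}}|%:R))).
  by move: bad0_le; lra.
rewrite mulrA ler_wpM2r // exprS invfM mulrA ler_piMl ?invr_ge0 ?exprn_ge0 //.
by rewrite ler_pdivrMr // mul1r.
Qed.
End Symmetries.

(** * Random polynomials *)

From mathcomp Require Import all_classical all_reals all_analysis.
From mathcomp Require Import measurable_realfun.

Import numFieldNormedType.Exports.

Local Open Scope classical_set_scope.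
Local Open Scope ring_scope.

(** * Measurability of the near-double-root event *)

Section Measurability.
Variables (R : realType) (d : measure_display) (T : measurableType d).

Lemma continuous_norm_horner (p : {poly R}) : continuous (fun x => `|p.[x]| : R).
Proof.
move=> x; apply: (@cvg_norm _ _ _ _ _ (horner p)); exact: continuous_horner.
Qed.

(* By compactness a near-double root exists in [[-M, M]] as soon as there are
   approximate ones at rational points for every tolerance. *)
Lemma exists_near_double_rat (p : {poly R}) (delta : R) :
  (exists x, p.[x] = 0 /\ `|p^`().[x]| <= delta) <->
  (exists M : nat, forall k : nat, exists q : rat,
     [/\ `|ratr q| <= M%:R :> R, `|p.[ratr q]| < k.+1%:R^-1 &
         `|p^`().[ratr q]| < delta + k.+1%:R^-1]).
Proof.
split=> [[x [px dpx]]|[M H]].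
  exists (Num.bound `|x|).+1 => k.
  have e0 : 0 < k.+1%:R^-1 :> R by rewrite invr_gt0.
  have c1 := @continuous_norm_horner p x; have c2 := @continuous_norm_horner p^`() x.
  have n1 : \forall y \near x, `|p.[y]| < k.+1%:R^-1.
    by apply: (cvgr_lt _ c1); rewrite px normr0.
  have n2 : \forall y \near x, `|p^`().[y]| < delta + k.+1%:R^-1.
    by apply: (cvgr_lt _ c2); apply: le_lt_trans dpx _; rewrite ltrDl.
  have n3 : \forall y \near x, `|y| < (Num.bound `|x|).+1%:R.
    apply: (cvgr_lt _ (@norm_continuous _ R x)).
    by apply: lt_le_trans (archi_boundP _) _ => //; rewrite ler_nat.
  have [e /= e_gt0 He] : nbhs x [set y | [/\ `|p.[y]| < k.+1%:R^-1,
      `|p^`().[y]| < delta + k.+1%:R^-1 & `|y| < (Num.bound `|x|).+1%:R]].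
    by near=> y; split; near: y.
  have [q] := @rat_in_itvoo _ x (x + e) (ltr_pwDr e_gt0 (lexx x)).
  rewrite in_itv /= => /andP[q1 q2].
  have [h1 h2 h3] : [/\ `|p.[ratr q]| < k.+1%:R^-1,
      `|p^`().[ratr q]| < delta + k.+1%:R^-1 & `|ratr q| < (Num.bound `|x|).+1%:R :> R].
    by apply: He; rewrite /ball_ /= distrC gtr0_norm ?subr_gt0 // ltrBlDl.
  by exists q; split=> //; exact: ltW.
(* [phi x <= 0] says exactly that [x] is a near-double root; its minimum on [[-M, M]] is attained
   and is below every positive tolerance. *)
pose phi x : R := Num.max `|p.[x]| (`|p^`().[x]| - delta).
have phi_cont : continuous phi.
  move=> x; apply: (@continuous_max _ _ (fun x => `|p.[x]|) (fun x => `|p^`().[x]| - delta)).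
    exact: continuous_norm_horner.
  by apply: cvgB; [exact: continuous_norm_horner|exact: cvg_cst].
have [||c cM cmin] := @EVT_min R phi (- M%:R) M%:R; first by rewrite ge0_cp.
  exact: continuous_subspaceT.
have phi_le0 : phi c <= 0.
  apply/ler_addgt0Pr => e e0; rewrite add0r.
  have [k ke] : exists k : nat, k.+1%:R^-1 < e.
    exists (Num.bound e^-1); rewrite invf_plt ?posrE //.
    apply: lt_trans (archi_boundP _) _; first by rewrite invr_ge0 ltW.
    by rewrite ltr_nat.
  have [q [qM h1 h2]] := H k.
  apply: le_trans (cmin (ratr q) _) _; first by rewrite in_itv /= -ler_norml.
  rewrite /phi ge_max (ltW (lt_trans h1 ke)) lerBlDl /=.
  by apply/ltW/(lt_le_trans h2); rewrite lerD2l ltW.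
move: phi_le0; rewrite /phi ge_max normr_le0 subr_le0 => /andP[/eqP pc dpc].
by exists c.
Unshelve. all: by end_near.
Qed.

Lemma measurable_near_double (F : T -> {poly R}) (delta : R) :
  (forall x, measurable_fun setT (fun w => (F w).[x])) ->
  (forall x, measurable_fun setT (fun w => (F w)^`().[x])) ->
  measurable [set w | exists x, (F w).[x] = 0 /\ `|(F w)^`().[x]| <= delta].
Proof.
move=> mF mdF.
rewrite (_ : [set w | _] = \bigcup_(M : nat) \bigcap_(k : nat) \bigcup_(q : rat)
   [set w | [/\ `|ratr q| <= M%:R :> R, `|(F w).[ratr q]| < k.+1%:R^-1 &
         `|(F w)^`().[ratr q]| < delta + k.+1%:R^-1]]); last first.
  apply/seteqP; split=> w /=.
    move=> /exists_near_double_rat[M H]; exists M => // k _.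
    by have [q qP] := H k; exists q.
  move=> [M _ H]; apply/exists_near_double_rat; exists M => k.
  by have [q _ qP] := H k I; exists q.
apply: bigcupT_measurable => M; apply: bigcapT_measurable => k.
apply: bigcupT_measurable_rat => q.
have [qM|qM] := boolP (`|ratr q| <= M%:R :> R); last first.
  rewrite (_ : [set w | _] = set0); first exact: measurable0.
  by apply/seteqP; split=> w // [].
rewrite (_ : [set w | _] = [set w | `|(F w).[ratr q]| < k.+1%:R^-1] `&`
   [set w | `|(F w)^`().[ratr q]| < delta + k.+1%:R^-1]); last first.
  by apply/seteqP; split=> w /= [] //.
have m1 (g : T -> R) c : measurable_fun setT g -> measurable [set w | `|g w| < c].
  move=> mg; have mng : measurable_fun setT (fun w => `|g w|) by exact: measurableT_comp.
  have := mng measurableT _ (@measurable_itv R `]-oo, c[).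
  rewrite setTI; congr measurable; apply/seteqP; split=> w /=; by rewrite in_itv.
by apply: measurableI; exact: m1.
Qed.

End Measurability.

Section RandomPoly.
Variables (R : realType) (d : measure_display) (T : measurableType d).
Variable P : probability T R.

Lemma prob_bigcup_fin (I : finType) (D : {set I}) (F : I -> set T) :
  (forall i, measurable (F i)) -> trivIset setT F ->
  P (\bigcup_(i in [set` D]) F i) = (\sum_(i in D) P (F i))%E.
Proof.
move=> mF tF; rewrite measure_fin_bigcup //.
- by rewrite -(bigfs _ (P := mem D) (index_enum_uniq I)) // => i _; rewrite mem_index_enum.
- exact: sub_trivIset tF.
Qed.

Variables (n : nat) (xi : 'I_n.+1 -> {RV P >-> R}).

Lemma measurable_random_poly (x : R) :
  measurable_fun setT (fun w => (random_poly xi w).[x]) /\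
  measurable_fun setT (fun w => (random_poly xi w)^`().[x]).
Proof.
split.
  under eq_fun do rewrite (horner_ord_poly (fun i => xi i _)).
  by apply: measurable_sum => i; apply: measurable_funM => //.
under eq_fun do rewrite (horner_deriv_ord_poly (fun i => xi i _)).
by apply: measurable_sum => i; apply: measurable_funM => //.
Qed.

Lemma measurable_double_root (a : R) :
  measurable [set w | double_root (random_poly xi w) a].
Proof.
have [m1 m2] := measurable_random_poly a.
have -> : [set w | double_root (random_poly xi w) a] =
    [set w | (random_poly xi w).[a] = 0] `&` [set w | (random_poly xi w)^`().[a] = 0] by [].
have m0 (g : T -> R) : measurable_fun setT g -> measurable [set w | g w = 0].
  by move=> mg; rewrite -[X in measurable X]setTI; exact: (mg measurableT [set 0] (measurable_set1 0)).
by apply: measurableI; exact: m0.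
Qed.

Lemma measurable_event (delta : R) : measurable
  [set w | exists x, (random_poly xi w).[x] = 0 /\ `|(random_poly xi w)^`().[x]| <= delta].
Proof.
by apply: measurable_near_double => x; have [] := measurable_random_poly x.
Qed.

Hypothesis indep : mutually_independent xi.

Lemma indep_all (A : 'I_n.+1 -> set R) : (forall i, measurable (A i)) ->
  P (\bigcap_i (xi i @^-1` A i)) = (\prod_i P (xi i @^-1` A i))%E.
Proof.
move=> mA; have := indep (J := [set: 'I_n.+1]%SET) (fun i _ => mA i).
rewrite (eq_bigl xpredT); last by move=> i; rewrite inE.
move=> <-; congr (P _); apply/seteqP; split=> w Aw i _; apply: Aw => //=.
by rewrite finset.inE.
Qed.

(** By independence every value pattern [z] has probability [#|S|^-(n+1)], so probabilities of sets
    of patterns are normalised counts. *)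
Lemma type_I_cover (S : finType) (val : S -> R) (c : R)
    (E D : set T) (bad : {set {ffun 'I_n.+1 -> S}}) :
  injective val -> (forall i a, P (xi i @^-1` [set val a]) = c%:E) ->
  #|S|%:R * c = 1 -> measurable E -> measurable D ->
  (forall w (z : {ffun 'I_n.+1 -> S}), (forall i, xi i w = val (z i)) -> E w -> D w \/ z \in bad) ->
  (P E <= P D + (#|bad|%:R / #|{: {ffun 'I_n.+1 -> S}}|%:R)%:E)%E.
Proof.
move=> val_inj Pc Sc mE mD ED.
pose F (z : {ffun 'I_n.+1 -> S}) := \bigcap_i (xi i @^-1` [set val (z i)]).
have mpre i a : measurable (xi i @^-1` [set val a]).
  by rewrite -[X in measurable X]setTI; exact: (measurable_funPT (xi i) measurableT).
have mF z : measurable (F z) by apply: fin_bigcap_measurable => // i _; exact: mpre.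
have PF z : P (F z) = (c ^+ n.+1)%:E.
  rewrite /F indep_all // (eq_bigr (fun=> c%:E)); last by move=> i _; rewrite Pc.
  by rewrite prodEFin prodr_const card_ord.
have tF : trivIset setT F.
  move=> z z' _ _ [w [Fz Fz']]; apply/ffunP => i; apply: val_inj.
  by rewrite -(Fz i I) -(Fz' i I).
have cE : c ^+ n.+1 = #|{: {ffun 'I_n.+1 -> S}}|%:R^-1.
  rewrite card_ffun card_ord natrX -exprVn; congr (_ ^+ _).
  have S0 : #|S|%:R != 0 :> R by apply/eqP => S0; move: Sc; rewrite S0 mul0r => /esym/eqP; rewrite oner_eq0.
  by apply: (mulfI S0); rewrite Sc mulfV.
(* The event that some coefficient takes another value; it is null because the patterns exhaust the
   total mass. *)
pose Z := ~` \bigcup_(z in [set` [set: {ffun 'I_n.+1 -> S}]%SET]) F z.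
have mU (B : {set {ffun 'I_n.+1 -> S}}) : measurable (\bigcup_(z in [set` B]) F z).
  by apply: fin_bigcup_measurable => //; exact: finite_finset.
have sumE (B : {set {ffun 'I_n.+1 -> S}}) :
    P (\bigcup_(z in [set` B]) F z) = (#|B|%:R / #|{: {ffun 'I_n.+1 -> S}}|%:R)%:E.
  rewrite prob_bigcup_fin // (eq_bigr (fun=> (c ^+ n.+1)%:E)); last by move=> z _; rewrite PF.
  by rewrite sumEFin sumr_const cE mulr_natl.
have PZ : P Z = 0%E.
  rewrite probability_setC // sumE cardsT mulfV ?subee //.
  by rewrite pnatr_eq0 -lt0n card_ffun expn_gt0 lt0n; apply/orP; left; apply/eqP => S0;
    move: Sc; rewrite S0 mul0r => /esym/eqP; rewrite oner_eq0.
have mZ : measurable Z by apply: measurableC.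
apply: (@le_trans _ _ (P (D `|` \bigcup_(z in [set` bad]) F z `|` Z))).
  apply: le_measure; rewrite ?inE //; first by do 2?[apply: measurableU => //].
  move=> w Ew; have [Zw|] := pselect (Z w); first by right.
  move=> /contrapT[z _ Fz]; left.
  by have [|?|zb] := ED w z _ Ew; [move=> i; exact: (Fz i I)|left|right; exists z].
apply: (@le_trans _ _ (P (D `|` \bigcup_(z in [set` bad]) F z) + P Z)%E).
  by apply: measureU2 => //; exact: measurableU.
rewrite PZ adde0 -sumE.
exact: measureU2.
Qed.

End RandomPoly.

(** * Coefficients with a density *)

Section Pivot.
Variables (R : realType) (d : measure_display) (T : measurableType d).
Variable P : probability T R.
Variables (n : nat) (eta : 'I_n.+1 -> {RV P >-> R}).
Hypothesis indep : forall A : 'I_n.+1 -> set R, (forall i, measurable (A i)) ->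
  P (\bigcap_i (eta i @^-1` A i)) = (\prod_i P (eta i @^-1` A i))%E.

Lemma measurable_RV_preimage (X : {RV P >-> R}) (A : set R) :
  measurable A -> measurable (X @^-1` A).
Proof.
by move=> mA; rewrite -[X in measurable X]setTI; exact: (measurable_funPT X measurableT).
Qed.

Lemma prob_bigsetU_le (Y : eqType) (s : seq Y) (F : Y -> set R) (X : {RV P >-> R}) (beta : R) :
  (forall y, measurable (F y)) -> (forall y, (P (X @^-1` F y) <= beta%:E)%E) ->
  measurable (\big[setU/set0]_(y <- s) F y) /\
  (P (X @^-1` \big[setU/set0]_(y <- s) F y) <= ((size s)%:R * beta)%:E)%E.
Proof.
move=> mF PF; elim: s => [|y s [IH1 IH2]].
  by rewrite big_nil preimage_set0 measure0 mul0r.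
rewrite big_cons; split; first exact: measurableU.
rewrite preimage_setU; apply: (@le_trans _ _ (P (X @^-1` F y) +
    P (X @^-1` \big[setU/set0]_(y <- s) F y))%E).
  by apply: measureU2; exact: measurable_RV_preimage.
by rewrite /= -natr1 mulrDl mul1r addrC EFinD leeD.
Qed.

(* The coefficients other than the pivot [eta 0] are discretised, which turns the
   conditioning on them into a countable disjoint union of product events [U z]. *)
Lemma pivot_cover (K : countType) (V : K -> 'I_n -> set R) (S : K -> set R) (beta : R) :
  0 <= beta ->
  (forall z j, measurable (V z j)) -> (forall z, measurable (S z)) ->
  (forall z, (P (eta ord0 @^-1` S z) <= beta%:E)%E) ->
  (forall z z' (r : 'I_n -> R), (forall j, V z j (r j)) -> (forall j, V z' j (r j)) -> z = z') ->
  exists U : set T, [/\ measurable U, (P U <= beta%:E)%E &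
    forall w z, (forall j, V z j (eta (lift ord0 j) w)) -> S z (eta ord0 w) -> U w].
Proof.
move=> beta0 mV mS PS disj.
pose box (A : set R) z (i : 'I_n.+1) := if unlift ord0 i is Some j then V z j else A.
pose G A z := \bigcap_i (eta i @^-1` box A z i).
have mbox A z i : measurable A -> measurable (box A z i).
  by move=> mA; rewrite /box; case: (unlift ord0 i).
have mG A z : measurable A -> measurable (G A z).
  by move=> mA; apply: fin_bigcap_measurable => // i _; apply: measurable_RV_preimage; exact: mbox.
have PG A z : measurable A -> P (G A z) = (P (eta ord0 @^-1` A) * P (G setT z))%E.
  move=> mA; rewrite /G !indep //; try by move=> i; exact: mbox.
  rewrite !big_ord_recl /box unlift_none preimage_setT probability_setT mul1e; congr (_ * _)%E.
  by apply: eq_bigr => j _; rewrite liftK.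
have GE A z w : (forall j, V z j (eta (lift ord0 j) w)) -> A (eta ord0 w) -> G A z w.
  by move=> Vw Aw i _; rewrite /= /box; case: unliftP => [j ->|->].
have GV A z w : G A z w -> forall j, V z j (eta (lift ord0 j) w).
  by move=> Gw j; have := Gw (lift ord0 j) Logic.I; rewrite /= /box liftK.
(* The sets are enumerated by codes; keeping only [k = pickle z] makes each [z] occur once, hence
   the unions disjoint. *)
pose FU k := if unpickle k is Some z then if pickle z == k then G (S z) z else set0 else set0.
pose FV k := if unpickle k is Some z then if pickle z == k then G setT z else set0 else set0.
have mFU k : measurable (FU k).
  by rewrite /FU; case: unpickle => // z; case: ifP => // _; exact: mG.
have mFV k : measurable (FV k).
  by rewrite /FV; case: unpickle => // z; case: ifP => // _; exact: mG.
have sub k : FU k `<=` FV k.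
  rewrite /FU /FV => w; case: unpickle => [z|] //; case: ifP => // _ Gw.
  by apply: GE => //; exact: GV Gw.
have FV_pickle k w : FV k w -> exists z, k = pickle z /\ forall j, V z j (eta (lift ord0 j) w).
  by rewrite /FV; case: unpickle => // z; case: eqP => // <- /GV Vz; exists z.
have tFV : trivIset setT FV.
  move=> i i' _ _ [w [/FV_pickle[z [-> Vz]] /FV_pickle[z' [-> Vz']]]].
  by rewrite (disj z z' _ Vz Vz').
have tFU : trivIset setT FU.
  by move=> i i' _ _ [w [/sub Fi /sub Fi']]; apply: tFV => //; exists w.
exists (\bigcup_k FU k); split; first exact: bigcupT_measurable.
  (* Each piece has probability at most [beta] times that of its box, and the disjoint boxes have
     total mass at most 1. *)
  rewrite measure_bigcup //.
  apply: (@le_trans _ _ (\sum_(0 <= k <oo | k \in setT) (beta%:E * P (FV k)))%E).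
    apply: lee_nneseries => [k _ _|k _]; first exact: measure_ge0.
    rewrite /FU /FV; case: unpickle => [z|]; last by rewrite !measure0 mule0.
    case: ifP => _; last by rewrite !measure0 mule0.
    have h : (P (G (S z) z) <= beta%:E * P (G setT z))%E; last exact: h.
    by rewrite (PG _ _ (mS z)); apply: lee_wpmul2r; [exact: measure_ge0|exact: PS].
  rewrite nneseriesZl; last by move=> k _; exact: measure_ge0.
  rewrite -measure_bigcup // -[leRHS]mule1 lee_wpmul2l // ?lee_fin //.
  by apply: probability_le1; exact: bigcupT_measurable.
move=> w z Vw Sw; exists (pickle z) => //; rewrite /FU pickleK eqxx.
exact: GE.
Qed.

(** Rounding the other coefficients leaves [|eta 0 + g(x)| <= delta] and [|g'(x)| <= 2 delta].
    Moving right by at most 2 to a candidate [y] changes [g] by at most [4 delta], which puts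
    [eta 0] within [5 delta] of [- g(y)]; there are at most [1 + (2 (n + 1) + 1)] candidates. *)
Lemma pivot_near_double (delta beta : R) : 0 < delta -> 0 <= beta ->
  (forall a, (P (eta ord0 @^-1` [set` `[a - 5 * delta, a + 5 * delta]%R]) <= beta%:E)%E) ->
  exists U : set T, [/\ measurable U, (P U <= ((n.*2 + 4)%:R * beta)%:E)%E &
    forall w x, `|x| <= 1 -> (ord_poly (fun i => eta i w)).[x] = 0 ->
      `|(ord_poly (fun i => eta i w))^`().[x]| <= delta -> U w].
Proof.
move=> d0 beta0 Pint.
(* Rounding to multiples of [1 / H] perturbs values and derivatives on [[-1, 1]] by at most
   [(n + 1)^2 / H]. *)
have [H H0 Hdelta] : exists2 H : nat, (0 < H)%N & n.+1%:R * n.+1%:R / H%:R <= delta.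
  exists (Num.bound (n.+1%:R * n.+1%:R / delta)).+1 => //.
  have q0 : 0 <= n.+1%:R * n.+1%:R / delta by rewrite divr_ge0 ?mulr_ge0 // ltW.
  have := archi_boundP q0; rewrite ltr_pdivrMr // => /ltW h.
  rewrite ler_pdivrMr //; apply: le_trans h _.
  by rewrite mulrC ler_wpM2l ?(ltW d0) // ler_nat.
have H0R : 0 < H%:R :> R by rewrite ltr0n.
pose K := {ffun 'I_n -> int}.
pose V (z : K) (j : 'I_n) : set R := [set r | Num.floor (r * H%:R) = z j].
pose cf (z : K) (i : 'I_n.+1) : R := if unlift ord0 i is Some j then (z j)%:~R / H%:R else 0.
pose g z := ord_poly (cf z).
have k0 : 0 <= 2 * delta by rewrite mulr_ge0 // ltW.
have /boolp.choice [rs rsP] := fun g => near_critical_candidates g k0.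
pose int_of (c : R) : set R := `[c - 5 * delta, c + 5 * delta]%classic.
pose S z := \big[setU/set0]_(y <- 1 :: rs (g z)) int_of (- (g z).[y]).
have mV z j : measurable (V z j).
  rewrite (_ : V z j = `[(z j)%:~R / H%:R, (z j + 1)%:~R / H%:R[%classic); first exact: measurable_itv.
  apply/seteqP; split=> r; rewrite /V /= in_itv /= ler_pdivrMr // ltr_pdivlMr // -floor_eq;
    by move/eqP.
have SP z : measurable (S z) /\ (P (eta ord0 @^-1` S z) <= ((n.*2 + 4)%:R * beta)%:E)%E.
  have [m1 m2] := @prob_bigsetU_le R (1 :: rs (g z)) (fun y => int_of (- (g z).[y])) (eta ord0) beta
    (fun y => measurable_itv _) (fun y => Pint _).
  split=> //; apply: le_trans m2 _; rewrite lee_fin ler_wpM2r // ler_nat /=.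
  have [+ _] := rsP (g z); have : (size (g z) <= n.+1)%N.
    rewrite /g /ord_poly; apply: (leq_trans (size_sum _ _ _)); apply/bigmax_leqP => i _.
    by apply: leq_trans (size_scale_leq _ _) _; rewrite size_polyXn.
  move: (size (rs (g z))) (size (g z)) => a b. lia.
have [||||z z' r h h'|U [mU PU HU]] := @pivot_cover K V S ((n.*2 + 4)%:R * beta).
- by rewrite mulr_ge0.
- exact: mV.
- by move=> z; have [] := SP z.
- by move=> z; have [] := SP z.
- by apply/ffunP => j; rewrite -(h j) -(h' j).
exists U; split=> // w x x1 Fx dFx.
pose z : K := [ffun j => Num.floor (eta (lift ord0 j) w * H%:R)].
apply: (HU w z); first by move=> j; rewrite /V /= ffunE.
pose e i := eta i w - (if i == ord0 then eta ord0 w else cf z i).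
have eH i : `|e i| <= H%:R^-1.
  rewrite /e; case: eqP => [->|/eqP i0]; first by rewrite subrr normr0 invr_ge0 ltW.
  rewrite /cf; case: unliftP i0 => [j ->|->]; last by rewrite eqxx.
  move=> _; rewrite ffunE; set r := eta _ w.
  have /andP[f1 f2] := floor_itv (r * H%:R).
  have -> : r - (Num.floor (r * H%:R))%:~R / H%:R =
      (r * H%:R - (Num.floor (r * H%:R))%:~R) / H%:R by rewrite mulrBl mulfK // gt_eqF.
  rewrite normrM [X in _ * X <= _]ger0_norm ?invr_ge0 ?(ltW H0R) //.
  rewrite -[leRHS]mul1r ler_wpM2r ?invr_ge0 ?(ltW H0R) //.
  by rewrite ger0_norm ?subr_ge0 // lerBlDl; move: f2; rewrite intrD => /ltW.
have FE : ord_poly (fun i => eta i w) = ord_poly e + (eta ord0 w)%:P + g z.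
  rewrite /g /ord_poly !big_ord_recl /= /e /cf !eqxx unlift_none subrr !scale0r !add0r.
  rewrite [X in _ = X + _]addrC -addrA; congr (_ + _); first by rewrite -alg_polyC expr0.
  rewrite -big_split /=; apply: eq_bigr => j _.
  by rewrite liftK -scalerDl subrK.
have [e1 e2] : `|(ord_poly e).[x]| <= delta /\ `|(ord_poly e)^`().[x]| <= delta.
  split; apply: le_trans Hdelta.
    apply: le_trans (ord_poly_le x1 eH) _; rewrite ler_wpM2r ?invr_ge0 //.
    by rewrite ler_peMl // ler1n.
  have [+ _] := deriv_ord_poly_le x1 eH => /le_trans; apply.
  by rewrite -[leRHS]mulrA ler_wpM2l // mulrC ler_wpM2r ?invr_ge0 // ler_nat.
have Fx' : `|eta ord0 w + (g z).[x]| <= delta.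
  move: Fx; rewrite FE !hornerD hornerC -addrA => /eqP; rewrite addrC addr_eq0 => /eqP ->.
  by rewrite normrN.
have dg : `|(g z)^`().[x]| <= 2 * delta.
  move: dFx; rewrite FE !derivD derivC addr0 hornerD => h.
  have := ler_normB ((ord_poly e)^`().[x] + (g z)^`().[x]) (ord_poly e)^`().[x].
  by rewrite addrC addKr; lra.
have x1' : x <= 1 by apply: le_trans (ler_norm _) x1.
have [y [/andP[xy y1] yrs ybnd]] := (rsP (g z)).2 _ _ x1' dg.
have gy : `|(g z).[y] - (g z).[x]| <= 4 * delta.
  apply: le_trans (poly_mean_value_le xy ybnd) _.
  have x_1 : - 1 <= x by move: x1; rewrite ler_norml => /andP[].
  by rewrite (_ : 4 * delta = 2 * (2 * delta)) ?ler_wpM2r //; lra.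
have in_int : int_of (- (g z).[y]) (eta ord0 w).
  have : `|eta ord0 w + (g z).[y]| <= 5 * delta.
    have := ler_normD (eta ord0 w + (g z).[x]) ((g z).[y] - (g z).[x]).
    by rewrite -addrA [_ + (_ - _)]addrC subrK; lra.
  by rewrite ler_norml /int_of /= in_itv /=; lra.
rewrite /S -bigcup_seq; exists y => //=.
by rewrite inE; case: yrs => [->|->]; rewrite ?eqxx ?orbT.
Qed.
End Pivot.

Lemma Lnorm_indic_itv (R : realType) (q a b : R) : 0 < q -> a <= b ->
  ('N[@lebesgue_measure R]_(q%:E) [EFin \o \1_([set` `[a, b]%R])] = ((b - a) `^ q^-1)%:E)%E.
Proof.
move=> q0 ab; rewrite unlock /=.
under eq_integral => x _.
  rewrite (_ : `|\1_([set` `[a, b]%R]) x| `^ q = \1_([set` `[a, b]%R]) x :> R); last first.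
    rewrite indicE; case: (_ \in _); rewrite /= ?normr1 ?normr0 ?powR1 //.
    by rewrite powR0 // gt_eqF.
  over.
rewrite integral_indic // setIT [X in (X `^ _)%E](lebesgue_measure_itv `[a, b]%R) /= lte_fin.
case: ltP => [_|ba]; first by rewrite -EFinB poweR_EFin.
have -> : b = a by apply/le_anti; rewrite ab ba.
by rewrite subrr -poweR_EFin.
Qed.

(** Hoelder's inequality for the density and the indicator of the interval, with the exponent
    conjugate to [p]. *)
Lemma type_II_interval (R : realType) (p eps0 K : R) (d : measure_display)
    (T : measurableType d) (P : probability T R) (X : {RV P >-> R}) (a b : R) :
  1 < p -> type_II p eps0 K X -> a <= b ->
  0 <= K /\ (P (X @^-1` [set` `[a, b]%R]) <= (K * (b - a) `^ (1 - p^-1))%:E)%E.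
Proof.
move=> p1 [_ [rho [mrho rho0 rhoP] rhoK] _] ab.
have p0 : 0 < p by apply: lt_trans p1.
have pV1 : p^-1 < 1 by rewrite invf_lt1.
have q0 : 0 < (1 - p^-1)^-1 by rewrite invr_gt0 subr_gt0.
split; first by rewrite -lee_fin; apply: le_trans rhoK; exact: Lnorm_ge0.
have mA : measurable [set` `[a, b]] by exact: measurable_itv.
have -> : P (X @^-1` [set` `[a, b]]) = distribution P X [set` `[a, b]] by [].
rewrite rhoP // integral_mkcond.
have -> : (\int[@lebesgue_measure R]_x ((fun x => (rho x)%:E) \_ [set` `[a, b]%R]) x =
    'N[@lebesgue_measure R]_1 [EFin \o (rho \* \1_([set` `[a, b]%R]))%R])%E.
  rewrite Lnorm1; apply: eq_integral => x _ /=.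
  rewrite patchE indicE; case: (_ \in _); last by rewrite mulr0 normr0.
  by rewrite mulr1 ger0_norm.
apply: le_trans (hoelder _ _ _ p0 q0 _) _ => //; first by rewrite invrK addrC subrK.
rewrite Lnorm_indic_itv // invrK EFinM lee_wpmul2r // lee_fin.
exact: powR_ge0.
Qed.

(** * Conclusion for each type of coefficients *)

Lemma near_double_type_I (R : realType) (N : nat) (C : R) : (0 < N)%N ->
  exists B : R, 0 < B /\
  exists n0 : nat, forall n : nat, (n0 <= n)%N ->
  forall (d : measure_display) (T : measurableType d) (P : probability T R)
    (xi : 'I_n.+1 -> {RV P >-> R}),
    mutually_independent xi -> (forall i, type_I N (xi i)) ->
    (P [set w | exists x : R, (random_poly xi w).[x] = 0 /\
                  `|(random_poly xi w)^`().[x]| <= n%:R `^ (- B)]%R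
     <= P [set w | double_root (random_poly xi w) 1 \/
                   double_root (random_poly xi w) (- 1)]%R
        + (n%:R `^ (- C))%:E)%E.
Proof.
case: N => // N _.
(* A pair [(k, b)] stands for [k + 1] with sign [b]: this leaves out zero and gives [u] the value
   1. *)
pose S : finType := ('I_N.+1 * bool)%type.
pose neg (a : S) : S := (a.1, ~~ a.2).
pose u : S := (ord0, false).
pose zval (a : S) : int := if a.2 then - (a.1.+1)%:Z else (a.1.+1)%:Z.
have negK : involutive neg by case=> k b; rewrite /neg /= negbK.
have neg_u : neg u != u by [].
have zvalN a : zval (neg a) = - zval a by case: a => k []; rewrite /zval /= ?opprK.
have zval_bnd a : (0 < `|zval a| <= N.+1)%N.
  by case: a => k []; rewrite /zval /= ?abszN; exact: ltn_ord.
have zval_inj : injective zval.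
  move=> [k b] [k' b'] E; have : (k.+1 = k'.+1)%N /\ b = b'.
    move: E; rewrite /zval /=; move: (nat_of_ord k) (nat_of_ord k').
    by case: b; case: b' => m m' E; split=> //; move: E; clear; lia.
  by move=> [[/val_inj ->] ->].
have [B [n0 H]] := @card_int_poly_double R S neg u zval N.+1 negK neg_u zvalN erefl zval_bnd
  (Num.bound `|C|).
(* The successor ensures positivity; it only shrinks the event. *)
exists B.+1%:R; split; first by rewrite ltr0n.
exists n0.+1 => n n0n d T P xi indep typ.
have n1 : 1 <= n%:R :> R by rewrite ler1n (leq_trans _ n0n).
have n0R : 0 < n%:R :> R by apply: lt_le_trans n1.
have {}H := H n (ltnW n0n).
set bad := finset _ in H.
pose vl (a : S) : R := (zval a)%:~R.
apply: (@le_trans _ _ (P [set w | double_root (random_poly xi w) 1 \/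
      double_root (random_poly xi w) (- 1)] +
    (#|bad|%:R / #|{: {ffun 'I_n.+1 -> S}}|%:R)%:E)%E).
  apply: (@type_I_cover R d T P n xi indep S vl (2 * N.+1%:R)^-1).
  - by move=> a a' /intr_inj /zval_inj.
  - move=> i a; have := typ i (zval a) (zval_bnd a); rewrite /pmf => <-.
    by rewrite fineK // fin_num_measure //; apply: measurable_RV_preimage.
  - by rewrite card_prod card_ord card_bool natrM mulrC [2 * _]mulrC mulVf //.
  - exact: measurable_event.
  - have -> : [set w | double_root (random_poly xi w) 1 \/ double_root (random_poly xi w) (- 1)]
      = [set w | double_root (random_poly xi w) 1] `|` [set w | double_root (random_poly xi w) (- 1)].
      by [].
    by apply: measurableU; exact: measurable_double_root.
  - move=> w z wz [x [Fx dFx]].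
    have FE : random_poly xi w = int_poly R zval z.
      by apply: eq_bigr => i _; rewrite wz.
    have [Dw|nD] := pselect (double_root (random_poly xi w) 1 \/
      double_root (random_poly xi w) (- 1)); [by left|right].
    rewrite inE; apply/asboolP; split; last by move: nD; rewrite FE.
    exists x; rewrite -FE; split=> //; apply: le_trans dFx _.
    rewrite powRN powR_mulrn ?ler0n // lef_pV2 ?posrE ?exprn_gt0 //.
    by rewrite ler_weXn2l.
rewrite leeD2l // lee_fin ler_pdivrMr; last by rewrite ltr0n card_ffun expn_gt0 card_prod card_ord card_bool.
apply: le_trans H _; rewrite ler_wpM2r // powRN.
rewrite lef_pV2 ?posrE ?powR_gt0 ?exprn_gt0 // -powR_mulrn ?ler0n //.
rewrite ler_powR //; apply: le_trans (ler_norm _) _.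
exact/ltW/archi_boundP.
Qed.

Lemma near_double_type_II (R : realType) (p eps0 K C : R) : 1 < p -> 0 < C ->
  exists B : R, 0 < B /\
  exists n0 : nat, forall n : nat, (n0 <= n)%N ->
  forall (d : measure_display) (T : measurableType d) (P : probability T R)
    (xi : 'I_n.+1 -> {RV P >-> R}),
    mutually_independent xi -> (forall i, type_II p eps0 K (xi i)) ->
    (P [set w | exists x : R, (random_poly xi w).[x] = 0 /\
                  `|(random_poly xi w)^`().[x]| <= n%:R `^ (- B)]%R
     <= (n%:R `^ (- C))%:E)%E.
Proof.
move=> p1 C0; pose r := 1 - p^-1.
have r0 : 0 < r by rewrite subr_gt0 invf_lt1 // (lt_trans _ p1).
(* Intervals of length [10 delta] then have probability at most [K 10^r n^(-C-2)]. The two pivots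
   use at most [2 (2 n + 4) <= 12 n] intervals, and the last factor [n] absorbs the constant. *)
exists ((C + 2) / r); split; first by rewrite divr_gt0 // addr_gt0.
exists (Num.bound (12 * `|K| * 10 `^ r) + 2)%N => n n0n d T P xi indep typ.
have n2 : (1 < n)%N by apply: leq_trans n0n; rewrite leq_addl.
have n0R : 0 < n%:R :> R by rewrite ltr0n ltnW.
set B := (C + 2) / r; pose delta : R := n%:R `^ (- B).
have d0 : 0 < delta by rewrite powR_gt0.
have [K0 _] := type_II_interval p1 (typ ord0) (lexx 0).
pose beta := K * (10 * delta) `^ r.
have beta0 : 0 <= beta by rewrite mulr_ge0 // powR_ge0.
have Pint i a : (P (xi i @^-1` [set` `[a - 5 * delta, a + 5 * delta]%R]) <= beta%:E)%E.
  have ab : a - 5 * delta <= a + 5 * delta by lra.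
  have [_] := type_II_interval p1 (typ i) ab.
  by rewrite (_ : a + 5 * delta - (a - 5 * delta) = 10 * delta) //; ring.
have [U1 [mU1 PU1 HU1]] := pivot_near_double (indep_all indep) d0 beta0 (Pint ord0).
have indep_rev (A : 'I_n.+1 -> set R) : (forall i, measurable (A i)) ->
    P (\bigcap_i (xi (rev_ord i) @^-1` A i)) = (\prod_i P (xi (rev_ord i) @^-1` A i))%E.
  move=> mA; have := indep_all indep (A := fun i => A (rev_ord i)) (fun i => mA _).
  rewrite (reindex_inj rev_ord_inj) /=.
  under eq_bigr do rewrite rev_ordK.
  move=> <-; congr (P _); apply/seteqP; split=> w Aw i _ /=;
    by have := Aw (rev_ord i) Logic.I; rewrite /= rev_ordK.
(* For roots with [|x| >= 1] the pivot is the leading coefficient. *)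
have [U2 [mU2 PU2 HU2]] := pivot_near_double indep_rev d0 beta0 (Pint (rev_ord ord0)).
apply: (@le_trans _ _ (P (U1 `|` U2))).
  apply: le_measure; rewrite ?inE; [exact: measurable_event|exact: measurableU|].
  move=> w [x [Fx dFx]]; have [x1|/ltW x1] := leP `|x| 1; first by left; exact: HU1 x1 Fx dFx.
  have [y1 Fy dFy] := near_double_rev n2 x1 Fx dFx.
  by right; exact: HU2 y1 Fy dFy.
apply: (@le_trans _ _ (P U1 + P U2)%E); first exact: measureU2.
apply: le_trans (leeD PU1 PU2) _; rewrite -EFinD lee_fin.
have -> : beta = K * 10 `^ r * (n%:R `^ (- C) / n%:R ^+ 2).
  rewrite /beta powRM ?ltW // /delta -powRrM mulNr /B divfK ?gt_eqF // opprD [n%:R `^ _]powRD; last first.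
    by rewrite (gt_eqF n0R) implybT.
  by rewrite [X in _ * (_ * (_ * X))]powRN powR_mulrn ?ler0n // mulrA.
have big : 12 * (K * 10 `^ r) <= n%:R.
  have h0 : 0 <= 12 * `|K| * 10 `^ r by rewrite !mulr_ge0 ?powR_ge0.
  rewrite mulrA -{1}(ger0_norm K0); apply: le_trans (ltW (archi_boundP h0)) _.
  by rewrite ler_nat (leq_trans _ n0n) // leq_addr.
have n4 : (n.*2 + 4)%:R <= 6 * n%:R :> R.
  by rewrite -natrM ler_nat; move: n2; clear; lia.
set X := K * 10 `^ r in big *; have X0 : 0 <= X by rewrite mulr_ge0 // powR_ge0.
set Y := n%:R `^ (- C); have Y0 : 0 <= Y by rewrite powR_ge0.
rewrite [X in X <= _](_ : _ = (n.*2 + 4)%:R * 2 * X * Y / n%:R ^+ 2); last by ring.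
rewrite ler_pdivrMr ?exprn_gt0 // mulrC ler_wpM2l //.
have h1 : (n.*2 + 4)%:R * (2 * X) <= 6 * n%:R * (2 * X) by rewrite ler_wpM2r // mulr_ge0.
have h2 : n%:R * (12 * X) <= n%:R * n%:R :> R by rewrite ler_wpM2l // ltW.
by rewrite expr2; lra.
Qed.

Theorem theorem1p9 (R : realType) (c : coef_class R) (hc : valid_class c)
    (C : R) (hC : 0 < C) :
  exists B : R, 0 < B /\
  exists n0 : nat, forall n : nat, (n0 <= n)%N ->
  forall (d : measure_display) (T : measurableType d) (P : probability T R)
    (xi : 'I_n.+1 -> {RV P >-> R}),
    mutually_independent xi ->
    (forall i, of_class c (xi i)) ->
    (P [set w | exists x : R, (random_poly xi w).[x] = 0 /\
                  `|(random_poly xi w)^`().[x]| <= n%:R `^ (- B)]%R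
     <= P [set w | double_root (random_poly xi w) 1 \/
                   double_root (random_poly xi w) (- 1)]%R
        + (n%:R `^ (- C))%:E)%E.
Proof.
case: c hc => [N|p eps0 K] /= hc; first exact: near_double_type_I.
have [B [B0 [n0 H]]] := @near_double_type_II R p eps0 K C hc.1 hC.
exists B; split=> //; exists n0 => n n0n d T P xi indep typ.
apply: le_trans (H n n0n d T P xi indep typ) _.
by rewrite leeDr.
Qed.
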